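(* Let $(b,c)$ be a (connected) weakly spherically symmetric graph over $X$ with respect to $o\in X$. Then every bounded harmonic function is zero if and only if $$\sum_{r=0}^\infty\frac{c(B_r)}{b_+(S_r)}=\infty.$$ Moreover, one has $Gc=1$ if and only if $G^bc=\infty$ for the Green function $G^b$ of the graph $b$.
   Context: Let $X$ be a countable set. A graph $(b,c)$ over $X$ consists of a symmetric function $b:X\times X\to[0,\infty)$ with $b(x,x)=0$ and $\sum_{y}b(x,y)<\infty$ for all $x$, and a killing term $c:X\to[0,\infty)$; one writes $b$ for $(b,0)$. All graphs are assumed connected: for all $x,y$ there are $x=y_1,\dots,y_{n+1}=y$ with $b(y_i,y_{i+1})>0$ for $1\le i\le n$. Let $\mathcal{F}=\{f:X\to\mathbb{R}\mid\sum_yb(x,y)|f(y)|<\infty\text{ for all }x\}$ and $\mathcal{L}f(x)=\sum_yb(x,y)(f(x)-f(y))+c(x)f(x)$ for $f\in\mathcal{F}$. A function $u\in\mathcal{F}$ is harmonic if $\mathcal{L}u=0$. Let $d$ be the path (combinatorial) distance: $d(x,y)$ is the least number of edges in a path from $x$ to $y$, where $x,y$ are joined by an edge iff $b(x,y)>0$. Let $S_r=S_r(o)=\{x\in X\mid d(x,o)=r\}$ and $B_r=B_r(o)=\{x\in X\mid d(x,o)\le r\}$. The graph is weakly spherically symmetric with respect to $o$ if, writing $r=d(x,o)$, the functions $b_\pm(x)=\sum_{y\in S_{r\pm1}(o)}b(x,y)$ and $c(x)$ depend only on $r$. For finite sets $A\subseteq X$, $b_\pm(A)=\sum_{x\in A}b_\pm(x)$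 and $c(A)=\sum_{x\in A}c(x)$ (spheres and balls are finite here). Conventions: $a/0=\infty$ for $a>0$ and $0/0=0$. Let $\mathcal{Q}(f)=\frac12\sum_{x,y}b(x,y)(f(x)-f(y))^2+\sum_xc(x)f(x)^2$ and let $L$ be the self-adjoint operator on $\ell^2(X)$ (counting measure) associated with the restriction of $\mathcal{Q}$ to $\mathcal{D}_0\cap\ell^2(X)$, where $\mathcal{D}_0$ is the closure of the finitely supported functions in $\{\mathcal{Q}<\infty\}$ with respect to $\sqrt{\mathcal{Q}(f)+|f(o)|^2}$. The Green function is $G(x,y)=\int_0^\infty(e^{-tL}1_{\{y\}})(x)\,dt\in(0,\infty]$ (finite iff the graph is transient), $G^b$ is the Green function of $(b,0)$, and $Gf(x)=\sum_yG(x,y)f(y)\in[0,\infty]$ for $f\ge0$, with $\infty\cdot0=0$ (similarly for $G^b$). $Gc=1$ means identically $1$; $G^bc=\infty$ means infinite at one, equivalently all, vertices. *)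

(* Defs.v *)
From HB Require Import structures.
From mathcomp Require Import all_boot all_order all_algebra.
From mathcomp Require Import all_classical all_reals all_analysis.

Set Implicit Arguments.
Unset Strict Implicit.
Unset Printing Implicit Defensive.

Import Order.TTheory GRing.Theory Num.Theory.
Import numFieldNormedType.Exports.

Local Open Scope classical_set_scope.
Local Open Scope ring_scope.

Section Summation.
Context {R : realType} {I : choiceType}.

(* Sum of an absolutely summable real family: sum of the positive parts minus
   sum of the negative parts.  It is only meaningful when the family is
   absolutely summable. *)
Definition rsum (f : I -> R) : R :=
  fine (\esum_(i in [set: I]) (Num.max (f i) 0)%:E) -
  fine (\esum_(i in [set: I]) (Num.max (- f i) 0)%:E).

Definition l2sq (f : I -> R) : \bar R := \esum_(i in [set: I]) (f i ^+ 2)%:E.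

Definition ell2 : set (I -> R) := [set f | (l2sq f < +oo)%E].

Definition l2norm (f : I -> R) : R := Num.sqrt (fine (l2sq f)).

Definition l2inner (f g : I -> R) : R := rsum (fun i => f i * g i).

End Summation.

Section Graph.
Context {R : realType} {X : countType}.
Implicit Types (b : X -> X -> R) (c : X -> R) (o x y : X) (f g h u : X -> R).

Definition is_graph b c : Prop :=
  [/\ forall x y, 0 <= b x y,
      forall x y, b x y = b y x,
      forall x, b x x = 0,
      forall x, (\esum_(y in [set: X]) (b x y)%:E < +oo)%E
    & forall x, 0 <= c x].

Definition adj b : rel X := fun x y => 0 < b x y.

Definition joined b (n : nat) x y : Prop :=
  exists p : seq X, [/\ path (adj b) x p, last x p = y & size p = n].

Definition connected_graph b : Prop := forall x y, exists n, joined b n x y.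

(* Equal to 0 by default when x and y are not connected. *)
Definition gdist b x y : nat :=
  xget 0%N [set n | joined b n x y /\ forall m, joined b m x y -> (n <= m)%N].

Definition gsphere b o (r : nat) : set X := [set x | gdist b x o = r].
Definition gball b o (r : nat) : set X := [set x | (gdist b x o <= r)%N].

Definition bplus b o x : \bar R :=
  \esum_(y in [set y | gdist b y o = (gdist b x o).+1]) (b x y)%:E.

(* The index set is empty for x = o: the sphere of radius -1 is empty. *)
Definition bminus b o x : \bar R :=
  \esum_(y in [set y | (gdist b y o).+1 = gdist b x o]) (b x y)%:E.

Definition weakly_spherically_symmetric b c o : Prop :=
  forall x y, gdist b x o = gdist b y o ->
    [/\ bplus b o x = bplus b o y, bminus b o x = bminus b o y & c x = c y].

Definition bplus_set b o (A : set X) : \bar R := \esum_(x in A) bplus b o x.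

Definition c_set c (A : set X) : \bar R := \esum_(x in A) (c x)%:E.

Definition in_F b f : Prop :=
  forall x, (\esum_(y in [set: X]) (b x y * `|f y|)%:E < +oo)%E.

Definition Lapl b c f x : R :=
  rsum (fun y => b x y * (f x - f y)) + c x * f x.

Definition graph_harmonic b c u : Prop := in_F b u /\ forall x, Lapl b c u x = 0.

Definition bounded_on_graph u : Prop := exists M : R, forall x, `|u x| <= M.

Definition Qform b c f : \bar R :=
  (2^-1%:E * (\esum_(p in [set: X * X]) (b p.1 p.2 * (f p.1 - f p.2) ^+ 2)%:E)
   + \esum_(x in [set: X]) (c x * f x ^+ 2)%:E)%E.

Definition Qbil b c f g : R :=
  2^-1 * rsum (fun p : X * X => b p.1 p.2 * (f p.1 - f p.2) * (g p.1 - g p.2))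
  + rsum (fun x => c x * f x * g x).

Definition formD0 b c o : set (X -> R) :=
  [set f | (Qform b c f < +oo)%E /\
    forall e : R, 0 < e -> exists phi : X -> R,
      finite_set [set x | phi x != 0] /\
      (Qform b c (fun x => f x - phi x)%R + (`|f o - phi o| ^+ 2)%:E
         < (e ^+ 2)%:E)%E].

(* Graph of the self-adjoint operator L associated with the closed form
   Qform restricted to formD0 `&` ell2: is_L b c o f g means that f is in the
   domain of L and L f = g. *)
Definition is_L b c o f g : Prop :=
  [/\ formD0 b c o f, ell2 f, ell2 g
    & forall h, formD0 b c o h -> ell2 h -> Qbil b c f h = l2inner g h].

(* T t f = e^{-tL} f for t >= 0 and f in ell2, that is, T is the strongly
   continuous semigroup of symmetric contractions on ell2 with generator -L.
   As L is self-adjoint and nonnegative, such a T exists, and it is unique for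
   these t and f; the values of T elsewhere are irrelevant. *)
Definition is_heat_semigroup b c o (T : R -> (X -> R) -> X -> R) : Prop :=
  [/\ [/\ forall (t : R) f, 0 <= t -> ell2 f -> ell2 (T t f),
          forall (t a : R) f g, 0 <= t -> ell2 f -> ell2 g ->
            T t (fun x => a * f x + g x) = (fun x => a * T t f x + T t g x),
          forall (t : R) f, 0 <= t -> ell2 f -> l2norm (T t f) <= l2norm f
        & forall (t : R) f g, 0 <= t -> ell2 f -> ell2 g ->
            l2inner (T t f) g = l2inner f (T t g)],
      forall f, ell2 f -> T 0 f = f,
      forall (s t : R) f, 0 <= s -> 0 <= t -> ell2 f ->
        T (s + t) f = T s (T t f),
      forall f, ell2 f ->
        l2norm (fun x => T t f x - f x) @[t --> 0^'+] --> (0 : R)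
    & forall f g, is_L b c o f g <->
        [/\ ell2 f, ell2 g
          & l2norm (fun x => t^-1 * (T t f x - f x) + g x)
              @[t --> 0^'+] --> (0 : R)]].

(* Here T is meant to be the heat semigroup of the graph. *)
Definition Green (T : R -> (X -> R) -> X -> R) x y : \bar R :=
  (\int[lebesgue_measure]_(t in `[0%R, +oo[) (T t \1_[set y] x)%:E)%E.

(* The product of extended reals satisfies +oo * 0 = 0. *)
Definition Green_op (T : R -> (X -> R) -> X -> R) f x : \bar R :=
  (\esum_(y in [set: X]) (Green T x y * (f y)%:E))%E.

End Graph.

(* Main.v *)
(* The balls of a weakly spherically symmetric graph are finite, so the graph is
   locally finite.  Let f be the radial solution of the harmonic equation with
   f(0) = 1: its flux b_+(S_r) (f(r+1) - f(r)) is the sum of c(S_k) f(k) over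
   k <= r, whence 1 + sum_(k<n) a_k <= f(n) <= exp (sum_(k<n) a_k) with
   a_k = c(B_k) / b_+(S_k).  If the series converges, f is a bounded nonzero
   harmonic function.  If it diverges, comparing a bounded harmonic u with
   (sup |u|) f(r) / f(n+1) on B_n by the maximum principle gives u = 0.

   For the Green functions, polarization of T_t 1_y (x) reduces everything to the
   integrals E(f) of t |-> <T_t f, f> for finitely supported f.  Writing
   w_N for the integral of T_t f over [0, N], one has L w_N = f - T_N f, and this
   identifies E(f) with the supremum of 2 <phi, f> - Q(phi) over finitely
   supported phi, hence with the limit of <G_n f, f>, where G_n is the Dirichlet
   Green operator of B_n.  This needs no positivity of the semigroup, since
   E(1_x - 1_y) is always finite.  On B_n the equation L w = c is solved
   by the radial functions 1 - f(r) / f(n+1), and by sum_(r<=k<=n) a_k in the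
   absence of killing, so G c = 1 and G^b c = oo both amount to the divergence of
   the series. *)
Require Import Defs.
From mathcomp Require Import all_boot all_order all_algebra.
From mathcomp Require Import all_classical all_reals all_analysis.
From mathcomp Require Import measurable_realfun finmap ring lra zify.
Set Implicit Arguments.
Unset Strict Implicit.
Unset Printing Implicit Defensive.
Import Order.TTheory GRing.Theory Num.Theory.
Import numFieldNormedType.Exports.
Local Open Scope classical_set_scope.
Local Open Scope ring_scope.

(** * Unconditional sums and square summable functions *)

(** The semigroup is known only through its axioms, so a substitute for the spectral theorem is
    needed: symmetry and the semigroup law give [<T_s f, T_t f> = |T_((s+t)/2) f|^2], hence
    [<T_t f, f>] is nonnegative and nonincreasing in [t]. If E(f) is finite, [N |T_N f|^2] therefore
    stays bounded and the error [<T_N f, phi>] disappears as N grows. The integral w_N is a family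
    of scalar integrals, and duality puts it in [ell2].

    A member of [formD0] is a limit of finitely supported functions only for the energy plus the
    value at [o], which does not control the [ell2] norm. Connectedness bounds [(h x - h y)^2] by a
    multiple of the energy of [h]; this suffices to pass to the limit in pairings with a finitely
    supported f, and it is also why E(1_x - 1_y) is finite.

    The argument of the overview needs every sphere to be nonempty. If [c = 0], or if the graph is
    finite, both equivalences are settled separately, with the conventions for division by zero
    deciding the series. *)

Lemma max0_subN {R : realDomainType} (a : R) :
  Num.max a 0 - Num.max (- a) 0 = a.
Proof.
have /orP[a0|a0] := le_total 0 a.
  by rewrite (max_l a0) (max_r (y := 0)) ?oppr_le0// subr0.
by rewrite (max_r a0) (max_l (y := 0)) ?oppr_ge0// opprK add0r.
Qed.

Section UnconditionalSums.
Context {R : realType} {I : choiceType}.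
Implicit Types (f g : I -> R) (s : seq I) (F : I -> \bar R).

Lemma sum_le_esum F s : uniq s -> (forall i, 0 <= F i)%E ->
  (\sum_(i <- s) F i <= \esum_(i in [set: I]) F i)%E.
Proof.
move=> us F0; apply: esum_ge; exists [set` s]; first by split.
by rewrite fsbig_seq.
Qed.

Lemma esum_le_bound F (M : \bar R) :
  (forall s, uniq s -> \sum_(i <- s) F i <= M)%E ->
  (\esum_(i in [set: I]) F i <= M)%E.
Proof.
move=> sM; apply: ge_ereal_sup => _ [A [finA _] <-].
by rewrite fsbig_finite//; apply: sM; exact: fset_uniq.
Qed.

Lemma esum_seq F s : uniq s -> (forall i, 0 <= F i)%E ->
  (forall i, i \notin s -> F i = 0%E) ->
  \esum_(i in [set: I]) F i = \sum_(i <- s) F i.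
Proof.
move=> us F0 Fs; apply/eqP; rewrite eq_le sum_le_esum// andbT.
apply: esum_le_bound => t ut.
rewrite (bigID (mem s))/= [X in (_ + X)%E]big1 ?adde0; last first.
  by move=> i /Fs.
rewrite -big_filter [leRHS](bigID (mem t))/= -[X in (_ <= X + _)%E]big_filter.
have st : perm_eq [seq i <- t | i \in s] [seq i <- s | i \in t].
  apply: uniq_perm; rewrite ?filter_uniq// => i.
  by rewrite !mem_filter andbC.
rewrite (perm_big _ st)/=.
by apply: leeDl; apply: sume_ge0.
Qed.

Definition abs_summable f := (\esum_(i in [set: I]) `|f i|%:E < +oo)%E.

Lemma abs_summable_bound f (M : R) :
  (forall s, uniq s -> \sum_(i <- s) `|f i| <= M) -> abs_summable f.
Proof.
move=> fM; apply: (@le_lt_trans _ _ M%:E); last exact: ltry.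
by apply: esum_le_bound => s us; rewrite sumEFin lee_fin; exact: fM.
Qed.

Lemma le_abs_summable f g : (forall i, `|f i| <= `|g i|) ->
  abs_summable g -> abs_summable f.
Proof.
move=> fg; apply: le_lt_trans; apply: le_esum => i _; rewrite lee_fin.
exact: fg.
Qed.

Lemma abs_summableD f g : abs_summable f -> abs_summable g ->
  abs_summable (fun i => f i + g i).
Proof.
rewrite /abs_summable => sf sg.
apply: le_lt_trans (lte_add_pinfty sf sg); rewrite -esumD//.
by apply: le_esum => i _; rewrite -EFinD lee_fin ler_normD.
Qed.

Lemma abs_summableZ (a : R) f : abs_summable f ->
  abs_summable (fun i => a * f i).
Proof.
move=> sf; apply: (@abs_summable_bound _
  (`|a| * fine (\esum_(i in [set: I]) `|f i|%:E))) => s us.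
under eq_bigr do rewrite normrM.
rewrite -mulr_sumr ler_wpM2l//.
rewrite -lee_fin fineK; last by rewrite ge0_fin_numE//; exact: esum_ge0.
by rewrite -sumEFin; exact: sum_le_esum.
Qed.

Lemma abs_summableN f : abs_summable f -> abs_summable (fun i => - f i).
Proof. by apply: le_abs_summable => i; rewrite normrN. Qed.

Lemma pos_part_fin f : abs_summable f ->
  \esum_(i in [set: I]) (Num.max (f i) 0)%:E \is a fin_num.
Proof.
move=> sf; rewrite ge0_fin_numE; last first.
  by apply: esum_ge0 => i _; rewrite lee_fin le_max lexx orbT.
apply: le_lt_trans sf; apply: le_esum => i _; rewrite lee_fin.
by rewrite ge_max ler_norm/=.
Qed.

(** Positive parts are not additive, but (f+g)^+ + f^- + g^- = (f+g)^- + f^+ + g^+ is an identity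
    between nonnegative families; it sums term by term, and finiteness of the six sums allows
    rearranging. *)
Lemma rsumD f g : abs_summable f -> abs_summable g ->
  rsum (fun i => f i + g i) = rsum f + rsum g.
Proof.
move=> sf sg.
pose P (h : I -> R) := \esum_(i in [set: I]) (Num.max (h i) 0)%:E.
have rsumE (h : I -> R) : rsum h = fine (P h) - fine (P (fun i => - h i)) by [].
have E : (P (fun i => f i + g i)%R + P (fun i => - f i)%R + P (fun i => - g i)%R =
          P (fun i => - (f i + g i))%R + P f + P g)%E.
  rewrite /P.
  have max0 (r : R) : (0 <= (Num.max r 0)%:E)%E.
    by rewrite lee_fin le_max lexx orbT.
  rewrite -!esumD; try by move=> i _; rewrite ?adde_ge0.
  apply: eq_esum => i _; rewrite -!EFinD; congr EFin.
  have m (a : R) := max0_subN a.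
  have := m (f i); have := m (g i); have := m (f i + g i).
  set a1 := Num.max _ _; set a2 := Num.max _ _; set a3 := Num.max _ _.
  set a4 := Num.max _ _; set a5 := Num.max _ _; set a6 := Num.max _ _.
  by move: (f i) (g i) a1 a2 a3 a4 a5 a6 => *; lra.
have fin (h : I -> R) : abs_summable h -> (fine (P h))%:E = P h.
  by move=> sh; rewrite fineK//; exact: pos_part_fin.
have sfg := abs_summableD sf sg.
move: E; rewrite -(fin _ sf) -(fin _ sg) -(fin _ sfg) -(fin _ (abs_summableN sf)).
rewrite -(fin _ (abs_summableN sg)) -(fin _ (abs_summableN sfg)).
rewrite !rsumE -!EFinD => -[].
by move: (fine _) (fine _) (fine _) (fine _) (fine _) (fine _) => *; lra.
Qed.

Lemma rsumN f : rsum (fun i => - f i) = - rsum f.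
Proof. by rewrite /rsum; under [X in _ - fine X]eq_esum do rewrite opprK; rewrite opprB. Qed.

Lemma rsum_ge0E f : (forall i, 0 <= f i) ->
  rsum f = fine (\esum_(i in [set: I]) (f i)%:E).
Proof.
move=> f0; rewrite /rsum [X in _ - fine X]esum1 ?subr0.
  by congr fine; apply: eq_esum => i _; rewrite max_l.
by move=> i _; rewrite max_r// oppr_le0.
Qed.

Lemma rsum_seq f s : uniq s -> (forall i, i \notin s -> f i = 0) ->
  rsum f = \sum_(i <- s) f i.
Proof.
move=> us fs; rewrite /rsum !(@esum_seq _ s)//.
- rewrite !sumEFin /= -sumrB; apply: eq_bigr => i _.
  exact: max0_subN.
- by move=> i; rewrite lee_fin le_max lexx orbT.
- by move=> i /fs ->; rewrite oppr0 maxxx.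
- by move=> i; rewrite lee_fin le_max lexx orbT.
- by move=> i /fs ->; rewrite maxxx.
Qed.

Lemma eq_rsum f g : f =1 g -> rsum f = rsum g.
Proof. by move=> /funext ->. Qed.

Lemma rsumZ (a : R) f : abs_summable f ->
  rsum (fun i => a * f i) = a * rsum f.
Proof.
have pos (b : R) (h : I -> R) : 0 <= b -> abs_summable h ->
    rsum (fun i => b * h i) = b * rsum h.
  move=> b0 sh; rewrite /rsum.
  have K (h' : I -> R) : abs_summable h' ->
    fine (\esum_(i in [set: I]) (Num.max (b * h' i) 0)%:E) =
    b * fine (\esum_(i in [set: I]) (Num.max (h' i) 0)%:E).
    move=> sh'; have fh := pos_part_fin sh'.
    have max0 i : 0 <= Num.max (h' i) 0 by rewrite le_max lexx orbT.
    have bmax i : Num.max (b * h' i) 0 = b * Num.max (h' i) 0.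
      by rewrite maxr_pMr// mulr0.
    apply/eqP; rewrite eq_le; apply/andP; split.
      rewrite -lee_fin fineK; last exact: pos_part_fin (abs_summableZ b sh').
      apply: esum_le_bound => s us; rewrite sumEFin lee_fin.
      under eq_bigr do rewrite bmax.
      rewrite -mulr_sumr ler_wpM2l// -lee_fin fineK//.
      by rewrite -sumEFin; apply: sum_le_esum => // i; rewrite lee_fin.
    have [<-|b_neq0] := eqVneq 0 b.
      by rewrite mul0r fine_ge0//; apply: esum_ge0 => i _; rewrite lee_fin le_max lexx orbT.
    have {}b0 : 0 < b by rewrite lt_def eq_sym b_neq0.
    rewrite -ler_pdivlMl// -lee_fin fineK//.
    apply: esum_le_bound => s us; rewrite sumEFin lee_fin ler_pdivlMl//.
    rewrite mulr_sumr -lee_fin fineK; last exact: pos_part_fin (abs_summableZ b sh').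
    under eq_bigr do rewrite -bmax.
    rewrite -sumEFin; apply: sum_le_esum => // i.
    by rewrite lee_fin le_max lexx orbT.
  rewrite K//; under [X in _ - fine X]eq_esum do rewrite -mulrN.
  by rewrite K ?mulrBr//; exact: abs_summableN.
move=> sf; have [a0|a0] := leP 0 a; first exact: pos.
have na : 0 <= - a by lra.
rewrite (_ : (fun i => a * f i) = (fun i => - ((- a) * f i))); last first.
  by apply/funext => i; rewrite mulNr opprK.
by rewrite rsumN pos// mulNr opprK.
Qed.

End UnconditionalSums.

(** * Inner product, duality and truncation for square summable functions *)

Section SquareSummable.
Context {R : realType} {I : choiceType}.
Implicit Types (f g h u v k : I -> R) (s : seq I).

Lemma l2sq_ge0 f : (0 <= l2sq f)%E.
Proof. by apply: esum_ge0 => i _; rewrite lee_fin sqr_ge0. Qed.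

Lemma l2norm_ge0 f : 0 <= l2norm f.
Proof. exact: sqrtr_ge0. Qed.

Lemma ell2_fin f : ell2 f -> (l2norm f ^+ 2)%:E = l2sq f.
Proof.
move=> ef; rewrite /l2norm sqr_sqrtr ?fineK//.
  by rewrite ge0_fin_numE//; exact: l2sq_ge0.
by rewrite fine_ge0// l2sq_ge0.
Qed.

Lemma sum_sq_le f s : ell2 f -> uniq s ->
  \sum_(i <- s) f i ^+ 2 <= l2norm f ^+ 2.
Proof.
move=> ef us; rewrite -lee_fin ell2_fin// -sumEFin.
by apply: sum_le_esum => // i; rewrite lee_fin sqr_ge0.
Qed.

Lemma ell2_bound f (C : R) : 0 <= C ->
  (forall s, uniq s -> \sum_(i <- s) f i ^+ 2 <= C ^+ 2) ->
  ell2 f /\ l2norm f <= C.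
Proof.
move=> C0 fC.
have le : (l2sq f <= (C ^+ 2)%:E)%E.
  by apply: esum_le_bound => s us; rewrite sumEFin lee_fin; exact: fC.
have ef : ell2 f by apply: le_lt_trans le _; exact: ltry.
split=> //; move: le; rewrite -(ell2_fin ef) lee_fin.
by rewrite ler_pXn2r// nnegrE l2norm_ge0.
Qed.

Lemma abs_summable_mul f g : ell2 f -> ell2 g ->
  abs_summable (fun i => f i * g i).
Proof.
move=> ef eg.
apply: (@abs_summable_bound _ _ _ (l2norm f ^+ 2 + l2norm g ^+ 2)) => s us.
apply: le_trans (lerD (sum_sq_le ef us) (sum_sq_le eg us)).
rewrite -big_split/=; apply: ler_sum => i _; rewrite normrM.
rewrite -(real_normK (num_real (f i))) -(real_normK (num_real (g i))).
nra.
Qed.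

Lemma ell2D (a : R) f g : ell2 f -> ell2 g -> ell2 (fun i => a * f i + g i).
Proof.
move=> ef eg.
apply: (proj1 (@ell2_bound _ (Num.sqrt (2 * (a ^+ 2 * l2norm f ^+ 2 +
  l2norm g ^+ 2))) (sqrtr_ge0 _) _)) => s us.
rewrite sqr_sqrtr; last first.
  by apply: mulr_ge0 => //; apply: addr_ge0; rewrite ?sqr_ge0// mulr_ge0// sqr_ge0.
have h1 := sum_sq_le ef us; have h2 := sum_sq_le eg us.
apply: (@le_trans _ _ (2 * (a ^+ 2 * \sum_(i <- s) f i ^+ 2 + \sum_(i <- s) g i ^+ 2))).
  rewrite mulr_sumr -big_split/= mulr_sumr; apply: ler_sum => i _.
  have := sqr_ge0 (a * f i - g i); nra.
by rewrite ler_wpM2l// lerD// ler_wpM2l// sqr_ge0.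
Qed.

Lemma ell2_0 : ell2 (fun _ : I => 0 : R).
Proof.
apply: (proj1 (@ell2_bound _ 0 (lexx _) _)) => s us.
by rewrite big1// expr0n.
Qed.

Lemma ell2_sub f g : ell2 f -> ell2 g -> ell2 (fun i => f i - g i).
Proof.
move=> ef eg; rewrite (_ : (fun i => _) = (fun i => (-1) * g i + f i)).
  exact: ell2D.
by apply/funext => i; rewrite mulN1r addrC.
Qed.

Lemma ell2Z (a : R) f : ell2 f -> ell2 (fun i => a * f i).
Proof.
move=> ef; rewrite (_ : (fun i => _) = (fun i => a * f i + 0)).
  by apply: ell2D => //; exact: ell2_0.
by apply/funext => i; rewrite addr0.
Qed.

Lemma ell2_seq f s : uniq s -> (forall i, i \notin s -> f i = 0) -> ell2 f.
Proof.
move=> us fs; rewrite /ell2/= /l2sq (@esum_seq _ _ _ s)//.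
- by rewrite sumEFin ltry.
- by move=> i; rewrite lee_fin sqr_ge0.
- by move=> i /fs ->; rewrite expr0n.
Qed.

Lemma l2innerC f g : l2inner f g = l2inner g f.
Proof. by apply: eq_rsum => i; rewrite mulrC. Qed.

Lemma l2innerDl (a : R) f g h : ell2 f -> ell2 g -> ell2 h ->
  l2inner (fun i => a * f i + g i) h = a * l2inner f h + l2inner g h.
Proof.
move=> ef eg eh; rewrite /l2inner -rsumZ; last exact: abs_summable_mul.
rewrite -rsumD; first by apply: eq_rsum => i; rewrite mulrDl mulrA.
- by apply: abs_summableZ; exact: abs_summable_mul.
- exact: abs_summable_mul.
Qed.

Lemma l2innerBl f g h : ell2 f -> ell2 g -> ell2 h ->
  l2inner (fun i => f i - g i) h = l2inner f h - l2inner g h.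
Proof.
move=> ef eg eh; rewrite (_ : (fun i => _) = (fun i => (-1) * g i + f i)).
  by rewrite l2innerDl// mulN1r addrC.
by apply/funext => i; rewrite mulN1r addrC.
Qed.

Lemma l2innerZl (a : R) f h : ell2 f -> ell2 h ->
  l2inner (fun i => a * f i) h = a * l2inner f h.
Proof.
move=> ef eh; rewrite /l2inner -rsumZ; last exact: abs_summable_mul.
by apply: eq_rsum => i; rewrite mulrA.
Qed.

Lemma l2inner_seq f g s : uniq s -> (forall i, i \notin s -> g i = 0) ->
  l2inner f g = \sum_(i <- s) f i * g i.
Proof. by move=> us gs; apply: rsum_seq => // i /gs ->; rewrite mulr0. Qed.

Lemma l2inner_self f : ell2 f -> l2inner f f = l2norm f ^+ 2.
Proof.
move=> ef; rewrite /l2inner rsum_ge0E; last by move=> i; rewrite -expr2 sqr_ge0.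
by apply: EFin_inj; rewrite ell2_fin// -[RHS]fineK// ge0_fin_numE// l2sq_ge0.
Qed.

Lemma l2innerBr f g h : ell2 f -> ell2 g -> ell2 h ->
  l2inner h (fun i => f i - g i) = l2inner h f - l2inner h g.
Proof. by move=> *; rewrite !(l2innerC h) l2innerBl. Qed.

Lemma l2_cauchy_schwarz f g : ell2 f -> ell2 g ->
  `|l2inner f g| <= l2norm f * l2norm g.
Proof.
move=> ef eg.
have key (t : R) :
    0 <= t ^+ 2 * l2norm f ^+ 2 + 2 * t * l2inner f g + l2norm g ^+ 2.
  have eh := ell2D t ef eg.
  have : 0 <= l2inner (fun i => t * f i + g i) (fun i => t * f i + g i).
    by rewrite l2inner_self// sqr_ge0.
  rewrite l2innerDl// (l2innerC f) (l2innerC g) !l2innerDl// !l2inner_self//.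
  rewrite (l2innerC g f) => h; apply: le_trans h _; rewrite le_eqVlt; apply/orP.
  by left; apply/eqP; ring.
have := l2norm_ge0 f; have := l2norm_ge0 g.
move: key; move: (l2norm f) (l2norm g) (l2inner f g) => a b z key b0 a0.
rewrite -(@ler_pXn2r _ 2%N) ?nnegrE ?mulr_ge0// real_normK ?num_real//.
have [a00|a00] := eqVneq a 0.
  have [->|z0] := eqVneq z 0; first by rewrite expr0n/= sqr_ge0.
  (* For [a = 0] the quadratic is affine in [t], and this [t] gives it the value -1. *)
  have := key (- (b ^+ 2 + 1) / (2 * z)).
  rewrite a00 (_ : _ + _ = -1); first by lra.
  by field.
(* The minimiser of the quadratic. *)
have := key (- z / a ^+ 2).
rewrite (_ : _ + _ = b ^+ 2 - z ^+ 2 / a ^+ 2); last by field.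
have a2 : 0 < a ^+ 2 by rewrite exprn_gt0// lt_def a00.
by rewrite subr_ge0 ler_pdivrMr// exprMn mulrC.
Qed.

(** Testing against the restriction of [v] to [s] bounds the square of its norm by [C] times its
    norm. This puts a function in [ell2] when only its pairings with finitely supported functions
    are known. *)
Lemma ell2_dual v (C : R) : 0 <= C ->
  (forall k s, uniq s -> (forall i, i \notin s -> k i = 0) ->
    `|\sum_(i <- s) v i * k i| <= C * l2norm k) ->
  ell2 v /\ l2norm v <= C.
Proof.
move=> C0 vC; apply: ell2_bound => // s us.
pose k i := if i \in s then v i else 0.
have ks i : i \notin s -> k i = 0 by rewrite /k => /negbTE ->.
have ek := ell2_seq us ks.
have E : \sum_(i <- s) v i * k i = \sum_(i <- s) v i ^+ 2.
  by apply: eq_big_seq => i si; rewrite /k si expr2.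
have nk : l2norm k ^+ 2 = \sum_(i <- s) v i ^+ 2.
  rewrite -l2inner_self// (l2inner_seq _ us ks).
  by apply: eq_big_seq => i si; rewrite /k si expr2.
have := vC k s us ks; rewrite E -nk ger0_norm ?sqr_ge0//.
by have := l2norm_ge0 k; nra.
Qed.

Lemma l2_truncate k (e : R) : ell2 k -> 0 < e ->
  exists s, uniq s /\
    l2norm (fun i => k i - (if i \in s then k i else 0)) <= e.
Proof.
move=> ek e0.
have lt : ((l2norm k ^+ 2 - e ^+ 2)%:E < l2sq k)%E.
  by rewrite -(ell2_fin ek) lte_fin ltrBlDr ltrDl exprn_gt0.
have [_ [A [finA _] <-]] := ereal_sup_gt lt.
rewrite fsbig_finite// sumEFin lte_fin => lts.
exists (fset_set A); split; first exact: fset_uniq.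
apply: (proj2 (@ell2_bound _ e (ltW e0) _)) => t ut.
apply: (@le_trans _ _ (\sum_(i <- t | i \notin fset_set A) k i ^+ 2)).
  rewrite [leRHS]big_mkcond/= ler_sum// => i _.
  by case: ifP; rewrite ?subrr ?expr0n// subr0.
rewrite -big_filter; set t' := [seq i <- t | i \notin fset_set A].
(* The truncation set already carries all but [e ^+ 2] of the squared norm, so a disjoint finite set
   carries at most [e ^+ 2]. *)
have ut' : uniq (fset_set A ++ t').
  rewrite cat_uniq fset_uniq filter_uniq// andbT/=.
  by apply/hasPn => i; rewrite mem_filter => /andP[].
have := sum_sq_le ek ut'; rewrite big_cat/=.
move: lts; lra.
Qed.

End SquareSummable.

(** * Distance to the root *)

Section Distance.
Context {R : realType} {X : countType} (b : X -> X -> R) (c : X -> R) (o : X).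
Hypotheses (hgraph : is_graph b c) (hconn : connected_graph b).

Let b0 x y : 0 <= b x y. Proof. by case: hgraph. Qed.
Let bC x y : b x y = b y x. Proof. by case: hgraph. Qed.

(** Connectedness makes the set in [gdist] nonempty, so the default value of [xget] does not
    occur. *)
Lemma gdistP x : joined b (gdist b x o) x o /\
  forall m, joined b m x o -> (gdist b x o <= m)%N.
Proof.
rewrite /gdist; case: xgetP => [n _ []//|].
have [m jm] := hconn x o.
have ex : exists n, `[< joined b n x o >] by exists m; apply/asboolP.
move=> /(_ (ex_minn ex)) /= []; case: ex_minnP => k /asboolP jk mk; split=> //.
by move=> p jp; apply: mk; apply/asboolP.
Qed.

Lemma gdist_root : gdist b o o = 0%N.
Proof.
have [_ /(_ 0%N)] := gdistP o; rewrite leqn0 => h; apply/eqP/h.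
by exists [::]; split.
Qed.

Lemma gdist_eq0 x : gdist b x o = 0%N -> x = o.
Proof.
move=> x0; have [] := gdistP x; rewrite x0 => -[p [_ lp /size0nil p0]] _.
by rewrite p0 in lp.
Qed.

Lemma gdist_adj x y : b x y != 0 -> (gdist b x o <= (gdist b y o).+1)%N.
Proof.
move=> bxy; have [_] := gdistP x; apply.
have [[p [pp lp sp]] _] := gdistP y.
by exists (y :: p); split=> //=; rewrite ?sp// pp andbT /adj lt_def bxy b0.
Qed.

Lemma gdist_pred x r : gdist b x o = r.+1 ->
  exists2 y, 0 < b x y & gdist b y o = r.
Proof.
move=> xr; have [] := gdistP x; rewrite xr => -[[|y p] [//= /andP[axy pp] lp [sp]]] _.
exists y => //; have [_ /(_ r)] := gdistP y; move=> H.
apply/eqP; rewrite eqn_leq H/=; last by exists p.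
by rewrite -ltnS -xr gdist_adj// gt_eqF.
Qed.

(** Connectedness as an induction principle: induction on a path from [x] to [y], peeling off its
    first edge. *)
Lemma path_adj_ind (P : X -> X -> Prop) : (forall x, P x x) ->
  (forall x y z, 0 < b x y -> P y z -> P x z) -> forall x y, P x y.
Proof.
move=> P0 Pb x y; have [n [p [+ + _]]] := hconn x y.
by elim: p x {n} => [x _ /= <-//|z p IH x /= /andP[axz pz] lp]; apply: (Pb _ z) => //; exact: IH.
Qed.

Hypothesis hminus : forall x y, gdist b x o = gdist b y o ->
  bminus b o x = bminus b o y.

(** By symmetry all vertices of the sphere of radius r+1 have the same [bminus], at least
    [b z y > 0] for one edge into the sphere of radius r. That sphere is finite by induction, so the
    total weight of the edges at its vertices is finite, and it can serve only finitely many
    vertices at this price. *)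
Lemma sphere_finite r : finite_set (gsphere b o r).
Proof.
elim: r => [|r IH].
  apply: (@sub_finite_set _ _ [set o]); last exact: finite_set1.
  by move=> x /gdist_eq0.
have [[z zr]|/forallNP none] := pselect (exists z, gdist b z o = r.+1); last first.
  apply: (@sub_finite_set _ _ set0); last exact: finite_set0.
  by move=> x /none.
have [y bzy yr] := gdist_pred zr.
have minus_gt x : gdist b x o = r.+1 -> ((b z y)%:E <= bminus b o x)%E.
  move=> xr; rewrite (@hminus x z) ?xr// /bminus.
  apply: esum_ge; exists [set y]; last by rewrite fsbig_set1.
  by split; [exact: finite_set1 | move=> _ ->/=; rewrite yr zr].
have fin_total : (\esum_(x in gsphere b o r) \esum_(y in [set: X]) (b x y)%:E < +oo)%E.
  rewrite esum_fset//; last by move=> i _; apply: esum_ge0 => j _; rewrite lee_fin.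
  rewrite fsbig_finite//=; apply/lte_sum_pinfty => i _.
  by case: hgraph.
apply: contrapT => inf.
have total (M : {fset X}) : [set` M] `<=` gsphere b o r.+1 ->
   ((#|` M|%:R * b z y)%:E <= \esum_(x in gsphere b o r) \esum_(y in [set: X]) (b x y)%:E)%E.
  move=> MS.
  apply: (@le_trans _ _ (\esum_(x in [set` M]) bminus b o x)%E).
    rewrite esum_fset//; last by move=> i _; apply: esum_ge0 => j _; rewrite lee_fin.
    rewrite fsbig_finite//= set_fsetK.
    apply: (@le_trans _ _ (\sum_(i <- M) (b z y)%:E)%E).
      by rewrite sumEFin lee_fin big_const_seq count_predT iter_addr_0 mulr_natl.
    by rewrite big_seq [leRHS]big_seq; apply: lee_sum => i iM; apply: minus_gt; exact: MS.
  have -> : \esum_(x in [set` M]) bminus b o x =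
      \esum_(x in [set` M]) \esum_(y in gsphere b o r) (b x y)%:E.
    apply: eq_esum => x /MS xr; rewrite /bminus; congr esum.
    by apply/seteqP; split=> w; rewrite /gsphere/= xr; [case|move=> ->].
  rewrite esum_fset//; last by move=> i _; apply: esum_ge0 => j _; rewrite lee_fin.
  rewrite fsbig_finite//= set_fsetK -esum_sum//; last by move=> *; rewrite lee_fin.
  apply: le_esum => w _.
  rewrite (_ : \sum_(j <- M) _ = \sum_(j <- M) (b w j)%:E)%E.
    by apply: sum_le_esum => // i; rewrite lee_fin.
  by apply: eq_bigr => j _; rewrite bC.
have [t tE] : exists t : R, \esum_(x in gsphere b o r) \esum_(y in [set: X]) (b x y)%:E = t%:E.
  exists (fine (\esum_(x in gsphere b o r) \esum_(y in [set: X]) (b x y)%:E)).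
  by rewrite fineK// ge0_fin_numE//; do 2 (apply: esum_ge0 => ? _); rewrite lee_fin.
have [n tn] : exists n, t / b z y < n%:R.
  by exists (Num.truncn (t / b z y)).+1; exact: truncnS_gt.
have [M MS cM] := infinite_set_fset n inf.
have := total M MS; rewrite tE lee_fin => le.
have : n%:R * b z y <= t.
  by apply: le_trans le; rewrite ler_wpM2r// ler_nat.
by move: tn; rewrite ltr_pdivrMr// => /lt_le_trans h /h; rewrite ltxx.
Qed.

Lemma ball_finite n : finite_set (gball b o n).
Proof.
apply: (@sub_finite_set _ _ (\bigcup_(r in `I_n.+1) gsphere b o r)).
  by move=> x xn; exists (gdist b x o).
by apply: bigcup_finite; [exact: finite_II|move=> *; exact: sphere_finite].
Qed.

End Distance.

(** * The Laplacian of a locally finite graph *)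

Lemma seq_argmin {R : realDomainType} {T : eqType} (phi : T -> R) (s : seq T) :
  s != [::] -> exists2 x, x \in s & forall y, y \in s -> phi x <= phi y.
Proof.
elim: s => // a [_ _|b s /(_ isT)[x xs xmin] _].
  by exists a; rewrite ?mem_head// => y; rewrite mem_seq1 => /eqP ->.
have [ax|/ltW xa] := leP (phi a) (phi x).
  exists a; rewrite ?mem_head// => y; rewrite inE => /predU1P[->//|/xmin].
  exact: le_trans.
exists x; first by rewrite inE xs orbT.
by move=> y; rewrite inE => /predU1P[->//|/xmin].
Qed.

Lemma sum_seq_delta {R : nzRingType} {T : eqType} (s : seq T) (f : T -> R) x :
  uniq s -> \sum_(y <- s) f y * (x == y)%:R = if x \in s then f x else 0.
Proof.
move=> us; have [xs|xs] := boolP (x \in s).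
  rewrite (bigD1_seq x)//= eqxx mulr1 big1 ?addr0// => y.
  by rewrite eq_sym => /negbTE ->; rewrite mulr0.
rewrite big_seq big1// => y ys; case: eqP => [xy|_]; last by rewrite mulr0.
by rewrite xy ys in xs.
Qed.

Section Energy.
Context {R : realType} {X : countType} (b : X -> X -> R) (c : X -> R) (o : X).
Hypotheses (hgraph : is_graph b c) (hconn : connected_graph b).
Hypothesis hfin : forall n, finite_set (gball b o n).
Implicit Types (f g h phi u w : X -> R).

Let b0 x y : 0 <= b x y. Proof. by case: hgraph. Qed.
Let bC x y : b x y = b y x. Proof. by case: hgraph. Qed.
Let c0 x : 0 <= c x. Proof. by case: hgraph. Qed.

Definition ball_seq n : seq X := fset_set (gball b o n).

Lemma ball_seq_uniq n : uniq (ball_seq n).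
Proof. exact: fset_uniq. Qed.

Lemma mem_ball_seq n x : (x \in ball_seq n) = (gdist b x o <= n)%N.
Proof. by rewrite in_fset_set//; apply/idP/idP => [/set_mem//|?]; exact/mem_set. Qed.

Definition supp_ball n phi := forall x, (n < gdist b x o)%N -> phi x = 0.

Lemma supp_ball_notin n phi x : supp_ball n phi -> x \notin ball_seq n -> phi x = 0.
Proof. by move=> sphi; rewrite mem_ball_seq -ltnNge; exact: sphi. Qed.

Lemma supp_ballW m n phi : (m <= n)%N -> supp_ball m phi -> supp_ball n phi.
Proof. by move=> mn sphi x nx; apply: sphi; exact: leq_ltn_trans nx. Qed.

Lemma supp_ball_finite phi : finite_set [set x | phi x != 0] ->
  exists n, supp_ball n phi.
Proof.
move=> fphi; exists (\max_(x <- fset_set [set x | phi x != 0%R]) gdist b x o)%N => x.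
rewrite ltnNge => xn; apply: contraNeq xn => phix.
apply: (@leq_bigmax_seq _ _ xpredT (fun x => gdist b x o)) => //.
by rewrite in_fset_set//; exact/mem_set.
Qed.

Lemma finite_supp_ball n phi : supp_ball n phi -> finite_set [set x | phi x != 0].
Proof.
move=> sphi; apply: (sub_finite_set _ (hfin n)) => x /=; rewrite /gball/=.
by apply: contraNT; rewrite -ltnNge => /sphi ->.
Qed.

Lemma neighbor_ball n x y : (gdist b x o < n)%N -> y \notin ball_seq n -> b x y = 0.
Proof.
rewrite mem_ball_seq -ltnNge => xn yn; apply: contraTeq xn => bxy.
rewrite -leqNgt -ltnS (leq_trans yn)//; apply: (gdist_adj o hgraph hconn).
by rewrite bC.
Qed.

(** The neighbours of [x] lie in the ball of radius d(x,o) + 1. The reduction to a finite sum makes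
    [Lapl] linear on all functions. *)
Lemma LaplE n f x : (gdist b x o < n)%N ->
  Lapl b c f x = \sum_(y <- ball_seq n) b x y * (f x - f y) + c x * f x.
Proof.
move=> xn; rewrite /Lapl (rsum_seq (ball_seq_uniq n))// => y yn.
by rewrite (neighbor_ball xn yn) mul0r.
Qed.

Lemma in_F_all f : in_F b f.
Proof.
move=> x; rewrite (esum_seq (ball_seq_uniq (gdist b x o).+1)).
- by rewrite sumEFin ltry.
- by move=> y; rewrite lee_fin mulr_ge0.
- by move=> y yn; rewrite (neighbor_ball _ yn)// mul0r.
Qed.

Lemma LaplD (a : R) f g x :
  Lapl b c (fun x => a * f x + g x) x = a * Lapl b c f x + Lapl b c g x.
Proof.
rewrite !(@LaplE (gdist b x o).+1)// (mulrDr a) addrACA; congr (_ + _); last by ring.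
by rewrite mulr_sumr -big_split/=; apply: eq_bigr => y _; ring.
Qed.

Lemma LaplB f g x :
  Lapl b c (fun x => f x - g x) x = Lapl b c f x - Lapl b c g x.
Proof.
rewrite (_ : (fun x => f x - g x) = (fun x => (-1) * g x + f x)).
  by rewrite LaplD mulN1r addrC.
by apply/funext => y; rewrite mulN1r addrC.
Qed.

Lemma Lapl_cst (k : R) x : Lapl b c (fun=> k) x = c x * k.
Proof. by rewrite (LaplE _ (ltnSn _)) big1 ?add0r// => y _; rewrite subrr mulr0. Qed.

(* Excludes the case X = B_n without killing, where constants are harmonic and the
   Dirichlet problem on B_n is singular. *)
Definition nondegenerate_ball n :=
  (exists z, 0 < c z) \/ (exists z, (n < gdist b z o)%N).

(** A negative value would give a global minimum, attained in the finite ball. The minimum value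
    spreads to all neighbours, hence by connectedness to the whole graph, and [c] vanishes wherever
    it is taken; each alternative of [nondegenerate_ball] contradicts this. *)
Lemma maximum_principle n phi : nondegenerate_ball n ->
  (forall x, (gdist b x o <= n)%N -> 0 <= Lapl b c phi x) ->
  (forall x, (n < gdist b x o)%N -> 0 <= phi x) -> forall x, 0 <= phi x.
Proof.
move=> nd Lphi off x; rewrite leNgt; apply/negP => phix.
have xn : x \in ball_seq n.
  by rewrite mem_ball_seq leqNgt; apply: contraTN phix => /off; rewrite leNgt.
have [z zn zmin] : exists2 z, z \in ball_seq n &
    forall y, y \in ball_seq n -> phi z <= phi y.
  by apply: seq_argmin; case: (ball_seq n) xn.
have phiz : phi z < 0 by apply: le_lt_trans phix; exact: zmin.
have {}zmin y : phi z <= phi y.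
  have [yn|yn] := leqP (gdist b y o) n; first by apply: zmin; rewrite mem_ball_seq.
  by apply: le_trans (ltW phiz) _; exact: off.
(* At a point with the negative minimal value both terms of the Laplacian are nonpositive, so its
   nonnegativity makes each of them vanish. *)
have step y : phi y = phi z -> c y = 0 /\ forall v, 0 < b y v -> phi v = phi z.
  move=> yz.
  have yn : (gdist b y o <= n)%N.
    by rewrite leqNgt; apply: contraTN phiz => /off; rewrite yz leNgt.
  have := Lphi y yn; rewrite (@LaplE (gdist b y o).+1)// => L0.
  have T0 v : 0 <= b y v * (phi v - phi y) by rewrite mulr_ge0// yz subr_ge0.
  have S0 : 0 <= \sum_(v <- ball_seq (gdist b y o).+1) b y v * (phi v - phi y).
    exact: sumr_ge0.
  have E : \sum_(v <- ball_seq (gdist b y o).+1) b y v * (phi y - phi v) =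
    - \sum_(v <- ball_seq (gdist b y o).+1) b y v * (phi v - phi y).
    by rewrite -sumrN; apply: eq_bigr => v _; ring.
  rewrite E yz in L0; have cy := c0 y; split.
    by apply/eqP; rewrite eq_le cy andbT leNgt; apply/negP => cy0; move: S0 L0; rewrite yz; nra.
  have S00 : \sum_(v <- ball_seq (gdist b y o).+1) b y v * (phi v - phi y) = 0.
    by move: S0 L0; rewrite yz; nra.
  move=> v byv; move: S00 => /eqP; rewrite psumr_eq0// => /allP /(_ v).
  rewrite mem_ball_seq implyTb mulf_eq0 gt_eqF//= subr_eq0 yz => H; apply/eqP/H.
  by apply: (gdist_adj o hgraph hconn); rewrite bC gt_eqF.
have all v : phi v = phi z.
  have P := path_adj_ind hconn (P := fun y v => phi y = phi z -> phi v = phi z).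
  apply: (P _ _ z v erefl) => // y v' w byv IH /step[_ /(_ _ byv)].
  exact: IH.
case: nd => [[v cv]|[v vn]].
  by have [cv0 _] := step v (all v); rewrite cv0 ltxx in cv.
by have := off v vn; rewrite all leNgt phiz.
Qed.

Lemma maximum_principle0 n phi : nondegenerate_ball n ->
  (forall x, (gdist b x o <= n)%N -> Lapl b c phi x = 0) ->
  supp_ball n phi -> forall x, phi x = 0.
Proof.
move=> nd Lphi off x; apply/eqP; rewrite eq_le; apply/andP; split.
  rewrite -oppr_ge0; apply: (@maximum_principle n (fun x => - phi x)) => // y yn.
    rewrite (_ : (fun x => - phi x) = (fun x => 0 - phi x)); last first.
      by apply/funext => t; rewrite sub0r.
    by rewrite LaplB Lapl_cst mulr0 Lphi// subr0.
  by rewrite off// oppr0.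
by apply: (@maximum_principle n) => // y yn; rewrite ?Lphi// off.
Qed.

Lemma Lapl_sum (I : Type) (r : seq I) (F : I -> X -> R) (a : I -> R) x :
  Lapl b c (fun y => \sum_(i <- r) a i * F i y) x =
  \sum_(i <- r) a i * Lapl b c (F i) x.
Proof.
elim: r => [|i r IH].
  rewrite big_nil (_ : (fun y => _) = (fun=> 0)) ?Lapl_cst ?mulr0//.
  by apply/funext => y; rewrite big_nil.
rewrite big_cons -IH -LaplD; congr (Lapl _ _ _ x); apply/funext => y.
by rewrite big_cons.
Qed.

(** A square linear system on the ball: a vector in the kernel of its matrix extends by zero to a
    function killed by [maximum_principle0], so the matrix is invertible. *)
Lemma dirichlet_problem n h : nondegenerate_ball n -> exists g,
  supp_ball n g /\ forall x, (gdist b x o <= n)%N -> Lapl b c g x = h x.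
Proof.
move=> nd; pose s := ball_seq n; pose N := size s; pose e (i : 'I_N) := nth o s i.
have es i : e i \in s by rewrite mem_nth.
have se x : x \in s -> exists i, x = e i.
  move=> xs; have xN : (index x s < N)%N by rewrite index_mem.
  by exists (Ordinal xN); rewrite /e/= nth_index.
have ee i j : (e i == e j) = (i == j).
  by rewrite nth_uniq// ball_seq_uniq.
pose d (j : 'I_N) (x : X) : R := (x == e j)%:R.
pose ext (v : 'rV[R]_N) (x : X) := \sum_(j <- index_enum 'I_N) v 0 j * d j x.
pose M := \matrix_(j < N, i < N) Lapl b c (d j) (e i).
have LE v i : Lapl b c (ext v) (e i) = (v *m M) 0 i.
  by rewrite Lapl_sum mxE; apply: eq_bigr => j _; rewrite mxE.
have supp v : supp_ball n (ext v).
  move=> x xn; rewrite /ext big1// => j _; rewrite /d.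
  case: eqP => [xe|_]; last by rewrite mulr0.
  by move: xn; rewrite xe ltnNge -mem_ball_seq es.
have extE v i : ext v (e i) = v 0 i.
  rewrite /ext (bigD1 i)//= big1 ?addr0; first by rewrite /d eqxx mulr1.
  by move=> j ji; rewrite /d ee eq_sym (negbTE ji) mulr0.
have uM : M \in unitmx.
  rewrite -row_free_unit -kermx_eq0; apply/eqP/row_matrixP => k; rewrite row0.
  set v := row k _; have vM : v *m M = 0.
    by rewrite -row_mul mulmx_ker row0.
  apply/rowP => i; rewrite -(extE v i) mxE.
  apply: (@maximum_principle0 n (ext v)) => // x xn.
  have [i' ->] : exists i, x = e i by apply: se; rewrite mem_ball_seq.
  by rewrite LE vM mxE.
exists (ext ((\row_i h (e i)) *m invmx M)); split=> // x xn.
have [i ->] : exists i, x = e i by apply: se; rewrite mem_ball_seq.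
by rewrite LE -mulmxA mulVmx// mulmx1 mxE.
Qed.

Lemma big_pairs (s : seq X) (F : X * X -> R) :
  \sum_(p <- [seq (x, y) | x <- s, y <- s]) F p =
  \sum_(x <- s) \sum_(y <- s) F (x, y).
Proof. by rewrite big_allpairs. Qed.

(** Green's formula. An edge that meets the support of [phi] stays in the ball of radius n+1, so
    both sums are finite for arbitrary [g]. *)
Lemma Qbil_fin n g phi : supp_ball n phi ->
  Qbil b c g phi = \sum_(x <- ball_seq n) phi x * Lapl b c g x.
Proof.
move=> sphi; rewrite /Qbil; set s := ball_seq n.+1.
have us : uniq s := ball_seq_uniq _.
have sphi' x : x \notin s -> phi x = 0.
  by apply: supp_ball_notin; exact: supp_ballW sphi.
rewrite (@rsum_seq _ _ _ [seq (x, y) | x <- s, y <- s]); first last.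
- move=> [x y] /=; have [xs|xs] := boolP (x \in s); have [ys|ys] := boolP (y \in s).
  + by case/negP; apply/allpairsP; exists (x, y).
  + move=> _; have [xn|xn] := leqP (gdist b x o) n.
      by rewrite (neighbor_ball _ ys)// !mul0r.
    by rewrite (sphi _ xn) (sphi' _ ys) subr0 mulr0.
  + move=> _; have [yn|yn] := leqP (gdist b y o) n.
      by rewrite bC (neighbor_ball _ xs)// !mul0r.
    by rewrite (sphi _ yn) (sphi' _ xs) subr0 mulr0.
  + by rewrite (sphi' _ xs) (sphi' _ ys) subr0 mulr0.
- by apply: allpairs_uniq => // -[? ?] [? ?].
rewrite big_pairs/= (@rsum_seq _ _ _ s)//; last by move=> i /sphi' ->; rewrite mulr0.
have -> : \sum_(x <- ball_seq n) phi x * Lapl b c g x =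
    \sum_(x <- s) phi x * (\sum_(y <- s) b x y * (g x - g y) + c x * g x).
  rewrite [RHS](bigID (mem (ball_seq n)))/= [X in _ + X]big1 ?addr0; last first.
    by move=> x /(supp_ball_notin sphi) ->; rewrite mul0r.
  rewrite -[RHS]big_filter; apply: etrans.
    apply: eq_big_seq => x; rewrite mem_ball_seq => xn.
    by rewrite (@LaplE n.+1)// -/s.
  apply: perm_big; apply: uniq_perm; rewrite ?filter_uniq ?ball_seq_uniq// => x.
  by rewrite mem_filter !mem_ball_seq; lia.
(* Split [phi x - phi y]; exchanging [x] and [y] in the second half, with [b] symmetric, turns it
   into the first. *)
have -> : \sum_(x <- s) \sum_(y <- s) b x y * (g x - g y) * (phi x - phi y) =
    2 * \sum_(x <- s) phi x * \sum_(y <- s) b x y * (g x - g y).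
  rewrite mulr_natl mulr2n.
  rewrite [X in _ = X + _](_ : _ = \sum_(x <- s) \sum_(y <- s) b x y * (g x - g y) * phi x).
    rewrite [X in _ = _ + X](_ : _ = \sum_(x <- s) \sum_(y <- s) b x y * (g x - g y) * - phi y).
      rewrite -big_split; apply: eq_bigr => x _; rewrite -big_split; apply: eq_bigr => y _ /=.
      by ring.
    rewrite [RHS]exchange_big; apply: eq_bigr => x _; rewrite mulr_sumr.
    by apply: eq_bigr => y _; rewrite bC; ring.
  by apply: eq_bigr => x _; rewrite mulr_sumr; apply: eq_bigr => y _; ring.
rewrite mulrA mulVf ?mul1r// -big_split; apply: eq_bigr => x _ /=; ring.
Qed.

Let Qterm_ge0 h p : 0 <= b p.1 p.2 * (h p.1 - h p.2) ^+ 2.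
Proof. by rewrite mulr_ge0// sqr_ge0. Qed.

Lemma Qform_Qbil h : (Qform b c h < +oo)%E -> Qform b c h = (Qbil b c h h)%:E.
Proof.
rewrite /Qform /Qbil.
rewrite [X in 2^-1 * X](_ : _ = rsum (fun p => b p.1 p.2 * (h p.1 - h p.2) ^+ 2)); last first.
  by apply: eq_rsum => p; rewrite expr2 mulrA.
rewrite [X in _ = (_ + X)%:E](_ : _ = rsum (fun x => c x * h x ^+ 2)); last first.
  by apply: eq_rsum => p; rewrite expr2 mulrA.
rewrite !rsum_ge0E//; last by move=> x; rewrite mulr_ge0// sqr_ge0.
set A := \esum_(p in _) _; set B := \esum_(x in _) _ => fin.
have A0 : (0 <= A)%E by apply: esum_ge0 => p _; rewrite lee_fin.
have B0 : (0 <= B)%E by apply: esum_ge0 => p _; rewrite lee_fin mulr_ge0// sqr_ge0.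
have Bf : B \is a fin_num.
  by rewrite ge0_fin_numE//; apply: le_lt_trans fin; rewrite leeDr// mule_ge0.
have Af : A \is a fin_num.
  rewrite ge0_fin_numE// ltey; apply/eqP => Ay; move: fin; rewrite Ay.
  by rewrite mulr_infty gtr0_sg// mul1e addye ?ltxx//; move: Bf; rewrite fin_numE => /andP[].
by rewrite -(fineK Af) -(fineK Bf).
Qed.

Lemma Qform_fin n phi : supp_ball n phi -> (Qform b c phi < +oo)%E.
Proof.
move=> sphi; set s := ball_seq n.+1.
have us : uniq s := ball_seq_uniq _.
have sphi' x : x \notin s -> phi x = 0.
  by apply: supp_ball_notin; exact: supp_ballW sphi.
rewrite /Qform (@esum_seq _ _ _ [seq (x, y) | x <- s, y <- s]); first last.
- move=> [x y] /=; have [xs|xs] := boolP (x \in s); have [ys|ys] := boolP (y \in s).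
  + by case/negP; apply/allpairsP; exists (x, y).
  + move=> _; have [xn|xn] := leqP (gdist b x o) n.
      by rewrite (neighbor_ball _ ys)// !mul0r.
    by rewrite (sphi _ xn) (sphi' _ ys) subr0 expr0n mulr0.
  + move=> _; have [yn|yn] := leqP (gdist b y o) n.
      by rewrite bC (neighbor_ball _ xs)// !mul0r.
    by rewrite (sphi _ yn) (sphi' _ xs) subr0 expr0n mulr0.
  + by rewrite (sphi' _ xs) (sphi' _ ys) subr0 expr0n mulr0.
- by move=> p; rewrite lee_fin.
- by apply: allpairs_uniq => // -[? ?] [? ?].
rewrite (@esum_seq _ _ _ s)//.
- by rewrite !sumEFin -EFinM -EFinD ltry.
- by move=> x; rewrite lee_fin mulr_ge0// sqr_ge0.
- by move=> x /sphi' ->; rewrite expr0n mulr0.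
Qed.

End Energy.

(** * Functions of finite energy *)

Lemma ler_rsum {R : realType} {I : choiceType} (f g : I -> R) :
  abs_summable f -> abs_summable g -> (forall i, f i <= g i) ->
  rsum f <= rsum g.
Proof.
move=> sf sg fg; rewrite -subr_ge0 -rsumN -rsumD//; last exact: abs_summableN.
rewrite rsum_ge0E; last by move=> i; rewrite subr_ge0.
by rewrite fine_ge0//; apply: esum_ge0 => i _; rewrite lee_fin subr_ge0.
Qed.

Section FiniteEnergy.
Context {R : realType} {X : countType} (b : X -> X -> R) (c : X -> R) (o : X).
Hypotheses (hgraph : is_graph b c) (hconn : connected_graph b).
Hypothesis hfin : forall n, finite_set (gball b o n).
Implicit Types (f g h phi u w : X -> R).

Let b0 x y : 0 <= b x y. Proof. by case: hgraph. Qed.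
Let bC x y : b x y = b y x. Proof. by case: hgraph. Qed.
Let c0 x : 0 <= c x. Proof. by case: hgraph. Qed.

Let grad w phi (p : X * X) := b p.1 p.2 * (w p.1 - w p.2) * (phi p.1 - phi p.2).
Let pot w phi x := c x * w x * phi x.

Let QbilE w phi : Qbil b c w phi = 2^-1 * rsum (grad w phi) + rsum (pot w phi).
Proof. by []. Qed.

Let grad_ge0 h p : 0 <= grad h h p.
Proof. by rewrite /grad -mulrA mulr_ge0// -expr2 sqr_ge0. Qed.

Let pot_ge0 h x : 0 <= pot h h x.
Proof. by rewrite /pot -mulrA mulr_ge0// -expr2 sqr_ge0. Qed.

Lemma Qbil_ge0 h : 0 <= Qbil b c h h.
Proof.
rewrite QbilE !rsum_ge0E// addr_ge0 ?mulr_ge0// fine_ge0//;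
by apply: esum_ge0 => p _; rewrite lee_fin.
Qed.

Let summable_energy h : (Qform b c h < +oo)%E ->
  abs_summable (grad h h) /\ abs_summable (pot h h).
Proof.
rewrite /Qform /abs_summable => fin.
rewrite (_ : esum _ _ = \esum_(p in [set: X * X])
    (b p.1 p.2 * (h p.1 - h p.2) ^+ 2)%:E); last first.
  by apply: eq_esum => p _; rewrite ger0_norm// /grad expr2 mulrA.
rewrite (_ : esum [set: X] _ = \esum_(x in [set: X]) (c x * h x ^+ 2)%:E); last first.
  by apply: eq_esum => p _; rewrite ger0_norm// /pot expr2 mulrA.
set A := (\esum_(p in [set: X * X]) _)%E in fin *.
set B := (\esum_(x in [set: X]) _)%E in fin *.
have A0 : (0 <= A)%E.
  by apply: esum_ge0 => p _; rewrite lee_fin mulr_ge0// sqr_ge0.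
have B0 : (0 <= B)%E by apply: esum_ge0 => p _; rewrite lee_fin mulr_ge0// sqr_ge0.
split; last by apply: le_lt_trans fin; rewrite leeDr// mule_ge0.
rewrite ltey; apply/eqP => Ay; move: fin; rewrite Ay.
by rewrite mulr_infty gtr0_sg// mul1e addye ?ltxx// gt_eqF// (lt_le_trans _ B0).
Qed.

Let summable_cross w phi : (Qform b c w < +oo)%E -> (Qform b c phi < +oo)%E ->
  abs_summable (grad w phi) /\ abs_summable (pot w phi).
Proof.
move=> /summable_energy[gw pw] /summable_energy[gp pp]; split.
  apply: le_abs_summable (abs_summableD gw gp) => p.
  rewrite [leRHS]ger0_norm ?addr_ge0// /grad -!mulrA -mulrDr normrM ger0_norm//.
  rewrite ler_wpM2l// ler_norml.
  have := sqr_ge0 ((w p.1 - w p.2) - (phi p.1 - phi p.2)).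
  have := sqr_ge0 ((w p.1 - w p.2) + (phi p.1 - phi p.2)).
  by move: (w p.1 - w p.2) (phi p.1 - phi p.2) => x y; nra.
apply: le_abs_summable (abs_summableD pw pp) => p.
rewrite [leRHS]ger0_norm ?addr_ge0// /pot -!mulrA -mulrDr normrM ger0_norm//.
rewrite ler_wpM2l// ler_norml.
have := sqr_ge0 (w p - phi p); have := sqr_ge0 (w p + phi p).
by move: (w p) (phi p) => x y; nra.
Qed.

(** The inequality [2 x y <= x^2 + y^2] on each term. When [w] solves L w = f weakly, it reads 2
    <phi, f> - Q(phi) <= Q(w), the source of the variational bounds. *)
Lemma Qbil_young w phi : (Qform b c w < +oo)%E -> (Qform b c phi < +oo)%E ->
  2 * Qbil b c w phi <= Qbil b c w w + Qbil b c phi phi.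
Proof.
move=> Qw Qphi; have [gx px] := summable_cross Qw Qphi.
have [[gw pw] [gp pp]] := (summable_energy Qw, summable_energy Qphi).
have G : 2 * rsum (grad w phi) <= rsum (grad w w) + rsum (grad phi phi).
  rewrite -rsumZ// -rsumD//; apply: ler_rsum.
  - exact: abs_summableZ.
  - exact: abs_summableD.
  - move=> p; rewrite /grad -!mulrA -mulrDr mulrCA ler_wpM2l//.
    by have := sqr_ge0 ((w p.1 - w p.2) - (phi p.1 - phi p.2)); nra.
have P : 2 * rsum (pot w phi) <= rsum (pot w w) + rsum (pot phi phi).
  rewrite -rsumZ// -rsumD//; apply: ler_rsum.
  - exact: abs_summableZ.
  - exact: abs_summableD.
  - move=> p; rewrite /pot -!mulrA -mulrDr mulrCA ler_wpM2l//.
    by have := sqr_ge0 (w p - phi p); nra.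
rewrite !QbilE; move: G P; set x1 := rsum _; set x2 := rsum _; set x3 := rsum _.
set x4 := rsum _; set x5 := rsum _; set x6 := rsum _.
by move: x1 x2 x3 x4 x5 x6 => *; lra.
Qed.

Let ler_young (d x y : R) : 0 < d ->
  y * y <= (1 + d) * (x * x) + (1 + d^-1) * ((x - y) * (x - y)).
Proof.
move=> d0; have dd : d^-1 * d = 1 by rewrite mulVf// gt_eqF.
have : 0 <= d^-1 * (d * x + (x - y)) ^+ 2.
  by rewrite mulr_ge0 ?sqr_ge0// invr_ge0 ltW.
have -> : d^-1 * (d * x + (x - y)) ^+ 2 = (d^-1 * d) * d * x * x +
   2 * (d^-1 * d) * x * (x - y) + d^-1 * ((x - y) * (x - y)) by ring.
by rewrite dd; move: (d^-1) => e; nra.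
Qed.

(** The weight [d] keeps the factor of Q(w) close to 1: with [d = eta] and Q(w - phi) <= eta^2, with
    eta <= 1, the last term is still at most 2 eta. *)
Lemma Qbil_triangle (d : R) w phi : 0 < d ->
  (Qform b c w < +oo)%E -> (Qform b c phi < +oo)%E ->
  (Qform b c (fun x => w x - phi x)%R < +oo)%E ->
  Qbil b c phi phi <= (1 + d) * Qbil b c w w +
    (1 + d^-1) * Qbil b c (fun x => w x - phi x) (fun x => w x - phi x).
Proof.
move=> d0 Qw Qphi Qd; have [gw pw] := summable_energy Qw.
have [[gp pp] [gd pd]] := (summable_energy Qphi, summable_energy Qd).
set v := fun x => w x - phi x in gd pd *.
have G : rsum (grad phi phi) <= (1 + d) * rsum (grad w w) + (1 + d^-1) * rsum (grad v v).
  rewrite -!rsumZ// -rsumD//; try exact: abs_summableZ.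
  apply: ler_rsum => //; first by apply: abs_summableD; exact: abs_summableZ.
  move=> p; rewrite /grad -!mulrA !(mulrCA _ (b _ _)) -mulrDr ler_wpM2l//.
  have -> : v p.1 - v p.2 = (w p.1 - w p.2) - (phi p.1 - phi p.2) by rewrite /v; ring.
  exact: ler_young.
have P : rsum (pot phi phi) <= (1 + d) * rsum (pot w w) + (1 + d^-1) * rsum (pot v v).
  rewrite -!rsumZ// -rsumD//; try exact: abs_summableZ.
  apply: ler_rsum => //; first by apply: abs_summableD; exact: abs_summableZ.
  move=> p; rewrite /pot -!mulrA !(mulrCA _ (c _)) -mulrDr ler_wpM2l//.
  exact: ler_young.
rewrite !QbilE; move: G P; set x1 := rsum _; set x2 := rsum _; set x3 := rsum _.
set x4 := rsum _; set x5 := rsum _; set x6 := rsum _.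
by move: x1 x2 x3 x4 x5 x6 (d^-1) => *; nra.
Qed.

(** A single edge bounds the squared difference of its ends by the energy, and such bounds combine
    along a path from [x] to [y]. *)
Lemma energy_difference x y : exists2 C : R, 0 <= C & forall h,
  (Qform b c h < +oo)%E -> (h x - h y) ^+ 2 <= C * Qbil b c h h.
Proof.
apply: (path_adj_ind hconn (P := fun x y => exists2 C : R, 0 <= C & forall h,
  (Qform b c h < +oo)%E -> (h x - h y) ^+ 2 <= C * Qbil b c h h)).
  by move=> {}x; exists 0 => // h _; rewrite subrr expr0n mul0r.
move=> {}x z {}y bxz [C C0 hC].
(* The ordered pair (x, z) contributes half of [b x z * (h x - h z) ^+ 2] to the energy; the outer 2
   comes from [(p + q)^2 <= 2 p^2 + 2 q^2]. *)
exists (2 * (2 / b x z + C)); first by rewrite mulr_ge0// addr_ge0// divr_ge0.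
move=> h Qh; have := hC h Qh.
have edge : (h x - h z) ^+ 2 <= 2 / b x z * Qbil b c h h.
  rewrite mulrAC ler_pdivlMr// mulrC.
  have [gh ph] := summable_energy Qh.
  have : grad h h (x, z) <= rsum (grad h h).
    rewrite rsum_ge0E// -lee_fin fineK; last first.
      rewrite ge0_fin_numE; last by apply: esum_ge0 => p _; rewrite lee_fin.
      by apply: le_lt_trans gh; apply: le_esum => p _; rewrite lee_fin ler_norm.
    apply: esum_ge; exists [set (x, z)]; last by rewrite fsbig_set1.
    by split; [exact: finite_set1|].
  have : 0 <= rsum (pot h h).
    rewrite rsum_ge0E// fine_ge0//; apply: esum_ge0 => p _; rewrite lee_fin//.
  rewrite QbilE [grad h h _]/grad/=; move: (rsum _) (rsum _) => A B; nra.
move: edge; move: (Qbil b c h h) (2 / b x z) => Q B edge.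
have := sqr_ge0 ((h x - h z) - (h z - h y)).
nra.
Qed.

(** Pairing with a finitely supported function is continuous for the norm that defines [formD0],
    because each value of [h] is controlled by its value at [o] and its energy. *)
Lemma energy_pairing (s : seq X) f : exists2 C : R, 0 <= C & forall h (eta : R),
  0 <= eta -> (Qform b c h < +oo)%E -> Qbil b c h h + h o ^+ 2 <= eta ^+ 2 ->
  `|\sum_(x <- s) h x * f x| <= C * eta.
Proof.
elim: s => [|a s [C C0 hC]].
  by exists 0 => // h eta _ _ _; rewrite big_nil normr0 mul0r.
have [D D0 hD] := energy_difference a o.
(* From [(h a)^2 <= 2 (h a - h o)^2 + 2 (h o)^2 <= (2 D + 2) eta^2], which is at most
   [((D + 2) eta)^2]. *)
exists (`|f a| * (D + 2) + C); first by rewrite addr_ge0// mulr_ge0// addr_ge0.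
move=> h eta eta0 Qh small; rewrite big_cons (le_trans (ler_normD _ _))//.
rewrite mulrDl lerD//; last exact: hC.
rewrite normrM [leLHS]mulrC -mulrA ler_wpM2l//.
rewrite -(@ler_pXn2r _ 2%N) ?nnegrE// ?mulr_ge0// ?addr_ge0//.
rewrite real_normK ?num_real//.
have := hD h Qh; have := Qbil_ge0 h; move: small; move: (Qbil b c h h) => Q.
move: (h a) (h o) => u v small Q0 uv.
have h1 : Q <= eta ^+ 2 by have := sqr_ge0 v; lra.
have h2 : v ^+ 2 <= eta ^+ 2 by lra.
have h3 : (u - v) ^+ 2 <= D * eta ^+ 2 by apply: le_trans uv _; rewrite ler_wpM2l.
have h4 : u ^+ 2 <= 2 * (u - v) ^+ 2 + 2 * v ^+ 2 by have := sqr_ge0 (u - 2 * v); nra.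
apply: (le_trans h4); rewrite exprMn.
apply: (@le_trans _ _ ((2 * D + 2) * eta ^+ 2)); first by lra.
by rewrite ler_wpM2r ?sqr_ge0//; have := sqr_ge0 D; nra.
Qed.

Lemma dirichlet_energy n f g : supp_ball b o n g ->
  (forall x, (gdist b x o <= n)%N -> Lapl b c g x = f x) ->
  Qbil b c g g = \sum_(x <- ball_seq b o n) g x * f x.
Proof.
move=> sg Lg; rewrite (Qbil_fin hgraph hconn hfin _ sg).
by apply: eq_big_seq => x; rewrite mem_ball_seq// => /Lg ->.
Qed.

(** By Green's formula [<phi, f>] is Q(g, phi) and the right-hand side is Q(g), so this is Young's
    inequality. Equality holds at [phi = g]: the Dirichlet solution maximises the functional over
    the ball. *)
Lemma dirichlet_variational n f g phi : supp_ball b o n g ->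
  (forall x, (gdist b x o <= n)%N -> Lapl b c g x = f x) ->
  supp_ball b o n phi ->
  2 * \sum_(x <- ball_seq b o n) phi x * f x - Qbil b c phi phi <=
  \sum_(x <- ball_seq b o n) g x * f x.
Proof.
move=> sg Lg sphi; rewrite -(dirichlet_energy sg Lg) lerBlDr.
have -> : \sum_(x <- ball_seq b o n) phi x * f x = Qbil b c g phi.
  rewrite (Qbil_fin hgraph hconn hfin _ sphi).
  by apply: eq_big_seq => x; rewrite mem_ball_seq// => /Lg ->.
by apply: Qbil_young; apply: (Qform_fin hgraph hconn hfin (n := n)).
Qed.

End FiniteEnergy.

(** * Integrals of continuous functions *)

Section IntegralFromZero.
Context {R : realType}.
Implicit Types (phi psi : R -> R) (a t N : R).

Lemma continuous_lin (a : R) phi psi : continuous phi -> continuous psi ->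
  continuous (fun s => a * phi s + psi s).
Proof.
move=> cphi cpsi s; apply: (@continuousD _ _ _ (fun s => a * phi s) psi); last exact: cpsi.
by apply: continuousM; [exact: cst_continuous|exact: cphi].
Qed.

Lemma continuous_translate (t : R) phi : continuous phi ->
  continuous (fun s => phi (s + t)).
Proof.
move=> cphi s; apply: (@continuous_comp _ _ _ (fun s => s + t)); last exact: cphi.
by apply: (@continuousD _ _ _ id (cst t)); [exact: cvg_id|exact: cst_continuous].
Qed.

Definition int0 N phi : R := \int[lebesgue_measure]_(s in `[0, N]) phi s.

Lemma int0_integrable N phi : continuous phi ->
  (@lebesgue_measure R).-integrable `[0, N] (EFin \o phi).
Proof.
move=> cphi; apply: continuous_compact_integrable; first exact: segment_compact.
exact: continuous_subspaceT.
Qed.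

Lemma int0E N phi : continuous phi ->
  (\int[lebesgue_measure]_(s in `[0%R, N]) (phi s)%:E = (int0 N phi)%:E)%E.
Proof.
by move=> cphi; rewrite /int0 /Rintegral fineK//; exact/integrable_fin_num/int0_integrable.
Qed.

Lemma eq_int0 N phi psi : (forall s, 0 <= s -> s <= N -> phi s = psi s) ->
  int0 N phi = int0 N psi.
Proof.
move=> E; apply: eq_Rintegral => s /set_mem/=; rewrite in_itv/= => /andP[? ?].
exact: E.
Qed.

Lemma int0D (a : R) N phi psi : continuous phi -> continuous psi ->
  int0 N (fun s => a * phi s + psi s) = a * int0 N phi + int0 N psi.
Proof.
move=> cphi cpsi; rewrite /int0 RintegralD//; last exact: int0_integrable.
- by rewrite RintegralZl//; exact: int0_integrable.
- apply: int0_integrable => s; apply: continuousM; last exact: cphi.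
  exact: cst_continuous.
Qed.

Lemma int0_ge0 N phi : (forall s, 0 <= s -> s <= N -> 0 <= phi s) -> 0 <= int0 N phi.
Proof. by move=> p0; apply: Rintegral_ge0 => s /=; rewrite in_itv/= => /andP[]; exact: p0. Qed.

Lemma int0_cst N (C : R) : 0 <= N -> int0 N (fun=> C) = C * N.
Proof.
move=> N0; rewrite /int0 Rintegral_cst//= lebesgue_measure_itv/= lte_fin.
have [->|Nneq0] := eqVneq N 0; first by rewrite ltxx mulr0.
by rewrite lt_def Nneq0 N0/= oppr0 addr0.
Qed.

Lemma int0_bound N (C : R) phi : 0 <= N -> continuous phi ->
  (forall s, 0 <= s -> s <= N -> `|phi s| <= C) -> `|int0 N phi| <= C * N.
Proof.
move=> N0 cphi bphi; rewrite -int0_cst// /int0.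
apply: le_trans (le_normr_Rintegral _ _) _ => //; first exact: int0_integrable.
apply: le_Rintegral => //.
- apply: int0_integrable => s; apply: continuous_comp; first exact: cphi.
  exact: norm_continuous.
- by apply: int0_integrable => s; exact: cst_continuous.
- by move=> s /=; rewrite in_itv/= => /andP[]; exact: bphi.
Qed.

Lemma int0_shift (a t : R) phi : continuous phi -> 0 <= a -> 0 <= t ->
  int0 (a + t) phi = int0 t phi + int0 a (fun s => phi (s + t)).
Proof.
move=> cphi a0 t0; apply/eqP; rewrite (addrC (int0 t _)) -subr_eq; apply/eqP.
rewrite /int0 Rintegral_itvB; last 3 first.
- exact: int0_integrable.
- by rewrite bnd_simp.
- by rewrite bnd_simp lerDr.
rewrite Rintegral_itv_obnd_cbnd; last first.
  apply: (integrableS _ _ _ (int0_integrable (a + t) cphi)) => //.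
  by move=> s /=; rewrite !in_itv/= => /andP[/ltW /(le_trans t0) -> ->].
have dF : forall s : R, is_derive s 1 (fun x : R => x + t) 1.
  by move=> s; rewrite -[X in is_derive _ _ _ X]addr0; exact: is_deriveD.
have D1 : derive1 (fun x : R => x + t) = cst 1.
  by apply/funext => s; rewrite derive1E derive_val.
have cF : continuous (fun x : R => x + t).
  by move=> s; apply: continuousD; [exact: cvg_id|exact: cst_continuous].
rewrite /Rintegral; congr fine.
have := @integration_by_substitution_increasing R (fun x => x + t) phi 0 a a0.
rewrite /= add0r => ->.
- by apply: eq_integral => s _; rewrite D1/= /GRing.mul/= mulr1.
- by move=> x y _ _; rewrite ltrD2r.
- by move=> x _; rewrite D1; exact: cst_continuous.
- by rewrite D1; exact: is_cvg_cst.
- by rewrite D1; exact: is_cvg_cst.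
- split.
  + by move=> x _; exact: (@ex_derive _ _ _ _ _ _ _ (dF x)).
  + by apply: cvg_at_right_filter; exact: cF.
  + by apply: cvg_at_left_filter; exact: cF.
- exact: continuous_subspaceT.
Qed.

(** Monotone convergence along the intervals from 0 to n. *)
Lemma integral_ge0_sup phi (M : \bar R) : continuous phi ->
  (forall s, 0 <= s -> 0 <= phi s) ->
  (forall N, 0 <= N -> ((int0 N phi)%:E <= M)%E) ->
  (\int[lebesgue_measure]_(s in `[0%R, +oo[) (phi s)%:E <= M)%E.
Proof.
move=> cphi p0 pM.
have mphi : measurable_fun setT phi by exact: continuous_measurable_fun.
pose F (n : nat) : set R := `[0, n%:R]%classic.
have E : `[0, +oo[%classic = \bigcup_n F n.
  apply/seteqP; split=> s /=.
    rewrite in_itv/= andbT => s0; exists (Num.truncn s).+1 => //=.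
    by rewrite /F/= in_itv/= s0 ltW// truncnS_gt.
  by move=> [n _] /=; rewrite /F/= !in_itv/= andbT => /andP[].
have C : (\int[lebesgue_measure]_(s in F n) (phi s)%:E)%E @[n --> \oo] -->
    (\int[lebesgue_measure]_(s in \bigcup_n F n) (phi s)%:E)%E.
  apply: ge0_nondecreasing_set_cvg_integral.
  - move=> m n mn; apply/subsetPset => s /=; rewrite /F/= !in_itv/= => /andP[-> /le_trans].
    by apply; rewrite ler_nat.
  - by move=> i; exact: measurable_itv.
  - by move=> i; apply/measurable_EFinP; exact: measurable_funTS.
  - by move=> n s; rewrite /F/= in_itv/= lee_fin => /andP[/p0].
rewrite E -(cvg_lim _ C)//; apply: lime_le; first by apply/cvg_ex; eexists; exact: C.
by apply: nearW => n; rewrite int0E//; exact: pM.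
Qed.

Lemma le_int0_integral N phi : continuous phi ->
  (forall s, 0 <= s -> 0 <= phi s) ->
  ((int0 N phi)%:E <= \int[lebesgue_measure]_(s in `[0%R, +oo[) (phi s)%:E)%E.
Proof.
move=> cphi p0; rewrite -int0E//; apply: ge0_subset_integral => //.
- by apply/measurable_EFinP/measurable_funTS; exact: continuous_measurable_fun.
- by move=> s /=; rewrite in_itv/= lee_fin andbT => /p0.
- by move=> s /=; rewrite !in_itv/= andbT => /andP[].
Qed.

(** The integral of [phi] may be infinite, so linearity for integrable functions does not apply.
    With F = phi - psi one has F^+ + psi = phi + F^-, and F^- <= psi has a finite integral, which
    allows the subtraction. *)
Lemma integral_sub_ge0 phi psi : continuous phi -> continuous psi ->
  (forall s, 0 <= phi s) -> (forall s, 0 <= psi s) ->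
  (\int[lebesgue_measure]_(s in `[0%R, +oo[) (psi s)%:E < +oo)%E ->
  (\int[lebesgue_measure]_(s in `[0%R, +oo[) (phi s - psi s)%:E =
   \int[lebesgue_measure]_(s in `[0%R, +oo[) (phi s)%:E -
   \int[lebesgue_measure]_(s in `[0%R, +oo[) (psi s)%:E)%E.
Proof.
move=> cphi cpsi phi0 psi0 fin; set D : set R := `[0, +oo[%classic.
have mD : measurable D by exact: measurable_itv.
have mphi : measurable_fun D (EFin \o phi).
  by apply/measurable_EFinP/measurable_funTS; exact: continuous_measurable_fun.
have mpsi : measurable_fun D (EFin \o psi).
  by apply/measurable_EFinP/measurable_funTS; exact: continuous_measurable_fun.
set F := fun s : R => (phi s - psi s)%:E.
have mF : measurable_fun D F by apply/measurable_EFinP/measurable_funB; apply/measurable_EFinP.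
have F0p s : (0 <= F^\+ s)%E by exact: funepos_ge0.
have F0n s : (0 <= F^\- s)%E by exact: funeneg_ge0.
have FnE s : (F^\- s <= (psi s)%:E)%E.
  by rewrite funenegE/= -EFin_max lee_fin ge_max psi0 opprB andbT gerBl.
have E : (\int[lebesgue_measure]_(s in D) F^\+ s + \int[lebesgue_measure]_(s in D) (psi s)%:E =
   \int[lebesgue_measure]_(s in D) (phi s)%:E + \int[lebesgue_measure]_(s in D) F^\- s)%E.
  rewrite -!ge0_integralD//; try by move=> *; rewrite lee_fin.
  - apply: eq_integral => s _; rewrite funeposE funenegE/= -!EFin_max -!EFinD.
    congr EFin; have := max0_subN (phi s - psi s).
    by move: (Num.max _ _) (Num.max _ _) => *; lra.
  - exact: measurable_funeneg.
  - exact: measurable_funepos.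
have Nfin : (\int[lebesgue_measure]_(s in D) F^\- s)%E \is a fin_num.
  rewrite ge0_fin_numE; last exact: integral_ge0.
  apply: le_lt_trans fin; apply: ge0_le_integral => //; exact: measurable_funeneg.
have Pfin : (\int[lebesgue_measure]_(s in D) (psi s)%:E)%E \is a fin_num.
  by rewrite ge0_fin_numE//; apply: integral_ge0 => s _; rewrite lee_fin.
transitivity (\int[lebesgue_measure]_(s in D) F^\+ s - \int[lebesgue_measure]_(s in D) F^\- s)%E.
  exact: integralE.
have cancel (A B P Q : \bar R) : (A + Q = P + B)%E -> B \is a fin_num ->
    Q \is a fin_num -> (A - B = P - Q)%E.
  case: A B P Q => [p| |] [q| |] [r| |] [t| |] //= [].
  by move=> eq4 _ _; congr EFin; lra.
exact: cancel E Nfin Pfin.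
Qed.

End IntegralFromZero.

(** * The heat semigroup *)

Section HeatSemigroup.
Context {R : realType} {X : countType} (b : X -> X -> R) (c : X -> R) (o : X).
Hypotheses (hgraph : is_graph b c) (hconn : connected_graph b).
Hypothesis hfin : forall n, finite_set (gball b o n).
Variable T : R -> (X -> R) -> X -> R.
Hypothesis hT : is_heat_semigroup b c o T.
Implicit Types (f g h k phi u w : X -> R) (s t N : R).

Let T_ell2 t f : 0 <= t -> ell2 f -> ell2 (T t f).
Proof. by case: hT => -[H _ _ _] *; exact: H. Qed.

Let T_sub t f g : 0 <= t -> ell2 f -> ell2 g ->
  T t (fun x => f x - g x) = (fun x => T t f x - T t g x).
Proof.
move=> t0 ef eg; have [[_ lin _ _] _ _ _ _] := hT.
rewrite (_ : (fun x => f x - g x) = (fun x => (-1) * g x + f x)).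
  by rewrite lin//; apply/funext => x; rewrite mulN1r addrC.
by apply/funext => y; rewrite mulN1r addrC.
Qed.

Let T_contr t f : 0 <= t -> ell2 f -> l2norm (T t f) <= l2norm f.
Proof. by case: hT => -[_ _ H _] *; exact: H. Qed.

Let T_sym t f g : 0 <= t -> ell2 f -> ell2 g ->
  l2inner (T t f) g = l2inner f (T t g).
Proof. by case: hT => -[_ _ _ H] *; exact: H. Qed.

Let T0 f : ell2 f -> T 0 f = f.
Proof. by case: hT => _ H _ _ _; exact: H. Qed.

Let T_add s t f : 0 <= s -> 0 <= t -> ell2 f -> T (s + t) f = T s (T t f).
Proof. by case: hT => _ _ H _ _; exact: H. Qed.

Let heat_modulus f (e : R) : ell2 f -> 0 < e ->
  exists2 d, 0 < d & forall t, 0 <= t -> t < d ->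
    l2norm (fun x => T t f x - f x) <= e.
Proof.
move=> ef e0; have [_ _ _ + _] := hT => /(_ f ef) /cvgrPdist_le /(_ e e0).
rewrite near_withinE => /nbhs_ballP[d d0 hd]; exists d => // t t0 td.
have [->|tn0] := eqVneq t 0.
  rewrite T0// (_ : (fun x => _) = (fun=> 0)); last first.
    by apply/funext => x; rewrite subrr.
  have E : l2norm (fun _ : X => 0 : R) ^+ 2 = 0.
    rewrite -l2inner_self ?(l2inner_seq _ (s := [::]))//; last exact: ell2_0.
    by rewrite big_nil.
  by move/eqP: E; rewrite sqrf_eq0 => /eqP ->; exact: ltW.
have := hd t; rewrite /ball/= sub0r normrN ger0_norm// => /(_ td).
rewrite lt_def tn0 t0 => /(_ isT); rewrite sub0r normrN ger0_norm//.
exact: l2norm_ge0.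
Qed.

Let T_diff s t f : 0 <= s -> s <= t -> ell2 f ->
  l2norm (fun x => T t f x - T s f x) <= l2norm (fun x => T (t - s) f x - f x).
Proof.
move=> s0 st ef; have ts0 : 0 <= t - s by rewrite subr_ge0.
have -> : T t f = T s (T (t - s) f) by rewrite -T_add// subrKC.
rewrite -(T_sub s0 (T_ell2 ts0 ef) ef).
by apply: T_contr => //; apply: ell2_sub => //; exact: T_ell2.
Qed.

(* The absolute value extends the pairing to a continuous function on the whole
   line; only nonnegative times matter. *)
Definition heat_pairing f k s : R := l2inner (T `|s| f) k.

Let heat_pairing_bound f k s : ell2 f -> ell2 k ->
  `|heat_pairing f k s| <= l2norm f * l2norm k.
Proof.
move=> ef ek; apply: le_trans (l2_cauchy_schwarz _ _) _ => //; first exact: T_ell2.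
by rewrite ler_wpM2r ?l2norm_ge0// T_contr.
Qed.

Let heat_pairing_sub f k s t : ell2 f -> ell2 k -> 0 <= s -> s <= t ->
  `|heat_pairing f k t - heat_pairing f k s| <=
  l2norm (fun x => T (t - s) f x - f x) * l2norm k.
Proof.
move=> ef ek s0 st; have t0 := le_trans s0 st.
rewrite /heat_pairing (ger0_norm s0) (ger0_norm t0) -l2innerBl//; try exact: T_ell2.
apply: le_trans (l2_cauchy_schwarz _ _) _ => //.
  by apply: ell2_sub; exact: T_ell2.
by rewrite ler_wpM2r ?l2norm_ge0// T_diff.
Qed.

(** For s <= t, [T t f - T s f] is the image under [T s] of [T (t - s) f - f]; contractivity carries
    strong continuity at 0 to every time. *)
Lemma heat_pairing_continuous f k : ell2 f -> ell2 k ->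
  continuous (heat_pairing f k).
Proof.
move=> ef ek s; apply/cvgrPdist_le => e e0.
have k1 : 0 < l2norm k + 1 by have := l2norm_ge0 k; lra.
have [d d0 hd] := heat_modulus ef (divr_gt0 e0 k1).
apply/nbhs_ballP; exists d => // t /=; rewrite /ball/= => std.
have abs_lt : `| `|s| - `|t| | < d by apply: le_lt_trans std; exact: ler_dist_dist.
have pabs r : heat_pairing f k r = heat_pairing f k `|r|.
  by rewrite /heat_pairing normr_id.
rewrite (pabs s) (pabs t).
have main r r' : 0 <= r -> r <= r' -> `|r' - r| < d ->
    `|heat_pairing f k r' - heat_pairing f k r| <= e.
  move=> r0 rr'; rewrite ger0_norm ?subr_ge0// => rd.
  apply: le_trans (heat_pairing_sub ef ek r0 rr') _.
  have := hd (r' - r); rewrite subr_ge0 => /(_ rr' rd) le.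
  apply: (@le_trans _ _ (e / (l2norm k + 1) * l2norm k)).
    by rewrite ler_wpM2r ?l2norm_ge0.
  by rewrite mulrAC ler_pdivrMr// ler_wpM2l ?ltW// ltrDl.
have [st|/ltW ts] := leP `|s| `|t|.
  by rewrite distrC; apply: main => //; rewrite distrC.
exact: main.
Qed.

Let heat_pairing_subr f k h s : ell2 f -> ell2 k -> ell2 h ->
  heat_pairing f (fun x => k x - h x) s = heat_pairing f k s - heat_pairing f h s.
Proof. by move=> ef ek eh; rewrite /heat_pairing l2innerBr//; exact: T_ell2. Qed.

Let del (x y : X) : R := (y == x)%:R.

Let delE x y : y \notin [:: x] -> del x y = 0.
Proof. by rewrite mem_seq1 /del => /negbTE ->. Qed.

Lemma ell2_del x : ell2 (del x).
Proof. by apply: (ell2_seq (s := [:: x])) => // y; exact: delE. Qed.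

Lemma l2inner_del g x : l2inner g (del x) = g x.
Proof.
by rewrite (l2inner_seq _ _ (delE (x := x)))// big_seq1 /del eqxx mulr1.
Qed.

(** The vector w_N of the overview, given by its coordinates: pairing with the point mass at [x]
    evaluates at [x], so only scalar integrals occur. *)
Definition heat_integral N f x : R := int0 N (heat_pairing f (del x)).

Let heat_integral_seq N f k (s : seq X) : ell2 f -> uniq s ->
  (forall x, x \notin s -> k x = 0) ->
  \sum_(x <- s) heat_integral N f x * k x = int0 N (heat_pairing f k).
Proof.
move=> ef us ks.
have -> : heat_pairing f k = fun t => \sum_(x <- s) k x * heat_pairing f (del x) t.
  apply/funext => t; rewrite /heat_pairing (l2inner_seq _ us ks).
  by apply: eq_bigr => x _; rewrite l2inner_del mulrC.
elim: (s) => [|x s' IH].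
  rewrite big_nil (_ : (fun t => _) = fun=> 0).
    by rewrite /int0 Rintegral_cst// mul0r.
  by apply/funext => t; rewrite big_nil.
rewrite big_cons IH mulrC -int0D; first last.
- elim: (s') => [|y s2 IH2].
    rewrite (_ : (fun t => _) = fun=> 0); first by move=> ?; exact: cst_continuous.
    by apply/funext => t; rewrite big_nil.
  rewrite (_ : (fun t => _) = (fun t => k y * heat_pairing f (del y) t +
     \sum_(x0 <- s2) k x0 * heat_pairing f (del x0) t)); last first.
    by apply/funext => t; rewrite big_cons.
  apply: continuous_lin; last exact: IH2.
  by apply: heat_pairing_continuous => //; exact: ell2_del.
- by apply: heat_pairing_continuous => //; exact: ell2_del.
- by congr int0; apply/funext => t; rewrite big_cons.
Qed.

Let int0_pairing_bound N f k : 0 <= N -> ell2 f -> ell2 k ->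
  `|int0 N (heat_pairing f k)| <= N * l2norm f * l2norm k.
Proof.
move=> N0 ef ek; rewrite -mulrA mulrC; apply: int0_bound => //.
  exact: heat_pairing_continuous.
by move=> s _ _; exact: heat_pairing_bound.
Qed.

Let heat_integral_dual N f : 0 <= N -> ell2 f ->
  ell2 (heat_integral N f) /\ l2norm (heat_integral N f) <= N * l2norm f.
Proof.
move=> N0 ef; apply: ell2_dual => [|k s us ks].
  by rewrite mulr_ge0// l2norm_ge0.
by rewrite heat_integral_seq// int0_pairing_bound//; exact: ell2_seq us ks.
Qed.

Lemma heat_integral_ell2 N f : 0 <= N -> ell2 f -> ell2 (heat_integral N f).
Proof. by move=> N0 ef; exact: (heat_integral_dual N0 ef).1. Qed.

(** For finitely supported [k] this is a finite sum of integrals. Both sides are bounded by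
    [N * l2norm f * l2norm k], and finitely supported functions are dense. *)
Lemma heat_integral_pairing N f k : 0 <= N -> ell2 f -> ell2 k ->
  l2inner (heat_integral N f) k = int0 N (heat_pairing f k).
Proof.
move=> N0 ef ek; have [ew nw] := heat_integral_dual N0 ef.
apply/eqP; rewrite -subr_eq0 -normr_eq0 eq_le normr_ge0 andbT.
apply/ler_addgt0Pr => e e0; rewrite add0r.
(* One summand [N * l2norm f] for each side of the identity; the [+ 1] makes the divisor
   positive. *)
pose C := 2 * (N * l2norm f) + 1.
have C0 : 0 < C by have := l2norm_ge0 f; rewrite /C; nra.
have [s [us]] := l2_truncate ek (divr_gt0 e0 C0).
set ks := fun x => if x \in s then k x else 0 => small.
have hks x : x \notin s -> ks x = 0 by rewrite /ks => /negbTE ->.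
have eks : ell2 ks := ell2_seq us hks.
have ed := ell2_sub ek eks.
have -> : l2inner (heat_integral N f) k - int0 N (heat_pairing f k) =
    l2inner (heat_integral N f) (fun x => k x - ks x) -
    int0 N (heat_pairing f (fun x => k x - ks x)).
  rewrite l2innerBr// (l2inner_seq _ us hks) heat_integral_seq//.
  rewrite (_ : heat_pairing f (fun x => k x - ks x) =
     (fun t => (-1) * heat_pairing f ks t + heat_pairing f k t)); last first.
    by apply/funext => t; rewrite heat_pairing_subr// mulN1r addrC.
  by rewrite int0D; [ring|exact: heat_pairing_continuous..].
apply: le_trans (ler_normB _ _) _.
apply: le_trans (lerD (l2_cauchy_schwarz ew ed) (int0_pairing_bound N0 ef ed)) _.
move: small nw; move: (l2norm_ge0 (fun x => k x - ks x)) (l2norm_ge0 f).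
set d := l2norm (fun x => _); set a := l2norm f; set W := l2norm _ => d0 a0 small nw.
have le1 : W * d + N * a * d <= C * d by rewrite /C -/a; nra.
apply: (le_trans le1); rewrite mulrC -ler_pdivlMr//.
Qed.

(** Let [v] be the error in the difference quotient and p(s) = <T_s f, v>. Symmetry moves [T t] onto
    [f], where it shifts time, so the overlapping parts of the integrals cancel and <v, v> is the
    mean over [0, t] of p(s + N) - p(N) - (p(s) - p(0)). Strong continuity makes this at most
    [e * l2norm v], hence [l2norm v <= e]. *)
Lemma heat_integral_is_L N f : 0 <= N -> ell2 f ->
  is_L b c o (heat_integral N f) (fun x => f x - T N f x).
Proof.
move=> N0 ef; set w := heat_integral N f; set g := fun x => f x - T N f x.
have ew : ell2 w by exact: heat_integral_ell2.
have eTN : ell2 (T N f) by exact: T_ell2.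
have eg : ell2 g by exact: ell2_sub.
have [_ _ _ _ gen] := hT; apply/gen; split=> //.
apply/cvgrPdist_le => e e0; rewrite near_withinE.
have e20 : 0 < e / 2 by lra.
have [d d0 hd] := heat_modulus ef e20.
apply/nbhs_ballP; exists d => // t; rewrite /ball/= sub0r normrN => td t0.
rewrite sub0r normrN ger0_norm ?l2norm_ge0//.
have t0' := ltW t0; rewrite gtr0_norm// in td.
set v := fun x => _.
have eTw : ell2 (T t w) by exact: T_ell2.
have ev : ell2 v by apply: ell2D => //; exact: ell2_sub.
have cv := heat_pairing_continuous ef ev.
have cvN := continuous_translate (t := N) cv.
pose dv s := heat_pairing f v (s + N) - heat_pairing f v N -
  (heat_pairing f v s - heat_pairing f v 0).
have dvE : dv = (fun s => 1 *
    (fun r => (-1) * heat_pairing f v r + heat_pairing f v (r + N)) s +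
    (heat_pairing f v 0 - heat_pairing f v N)).
  by apply/funext => s; rewrite /dv; ring.
have cc : continuous (fun _ : R => heat_pairing f v 0 - heat_pairing f v N).
  by move=> s; exact: cst_continuous.
have c1 : continuous (fun r => (-1) * heat_pairing f v r + heat_pairing f v (r + N)).
  exact: continuous_lin.
have cdv : continuous dv by rewrite dvE; exact: continuous_lin.
have E : l2inner v v = t^-1 * int0 t dv.
  rewrite {1}/v l2innerDl//; last exact: ell2_sub.
  rewrite l2innerBl// l2innerBl// T_sym// heat_integral_pairing//; last exact: T_ell2.
  rewrite (heat_integral_pairing N0 ef ev).
  have -> : int0 N (heat_pairing f (T t v)) = int0 N (fun s => heat_pairing f v (s + t)).
    apply: eq_int0 => s s0 _; rewrite /heat_pairing !ger0_norm ?addr_ge0//.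
    by rewrite -(T_sym t0' (T_ell2 s0 ef) ev) -T_add// addrC.
  have S1 := int0_shift cv N0 t0'; have S2 := int0_shift cv t0' N0.
  have -> : int0 N (fun s => heat_pairing f v (s + t)) =
     int0 N (heat_pairing f v) + int0 t (fun s => heat_pairing f v (s + N)) -
     int0 t (heat_pairing f v) by rewrite -S2 (addrC t N) S1 addrAC subrr add0r.
  rewrite dvE int0D// int0D// int0_cst//.
  have -> : l2inner f v = heat_pairing f v 0 by rewrite /heat_pairing normr0 T0.
  have -> : l2inner (T N f) v = heat_pairing f v N by rewrite /heat_pairing ger0_norm.
  by field; rewrite gt_eqF.
have bound : `|l2inner v v| <= e * l2norm v.
  rewrite E normrM ger0_norm ?invr_ge0// ler_pdivrMl// mulrC.
  apply: int0_bound => //.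
  move=> s s0 st; apply: le_trans (ler_normB _ _) _.
  have sd : s < d by exact: le_lt_trans td.
  have hs := hd s s0 sd; have v0 := l2norm_ge0 v.
  have h1 : `|heat_pairing f v (s + N) - heat_pairing f v N| <= e / 2 * l2norm v.
    apply: le_trans (heat_pairing_sub ef ev N0 _) _; first by rewrite lerDr.
    by rewrite addrK ler_wpM2r.
  have h2 : `|heat_pairing f v s - heat_pairing f v 0| <= e / 2 * l2norm v.
    apply: le_trans (heat_pairing_sub ef ev (lexx 0) s0) _.
    by rewrite subr0 ler_wpM2r.
  by apply: le_trans (lerD h1 h2) _; lra.
rewrite l2inner_self// ger0_norm ?sqr_ge0// in bound.
have := l2norm_ge0 v; move: bound; move: (l2norm v) => z; nra.
Qed.

(** Symmetry moves time between the two factors, so only [s + t] matters and it can be shared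
    equally. *)
Let pairing_half f s t : ell2 f -> 0 <= s -> 0 <= t ->
  l2inner (T s f) (T t f) = l2norm (T ((s + t) / 2) f) ^+ 2.
Proof.
move=> ef s0 t0; have h0 : 0 <= (s + t) / 2 by rewrite divr_ge0// addr_ge0.
have A (u v : R) : 0 <= u -> 0 <= v ->
    l2inner (T u f) (T v f) = l2inner (T (u + v) f) f.
  by move=> u0 v0; rewrite -(T_sym v0 (T_ell2 u0 ef) ef) -T_add// addrC.
rewrite -l2inner_self; last exact: T_ell2.
by rewrite !A//; congr (l2inner (T _ f) f); field.
Qed.

Let pairing_sq f s : ell2 f -> 0 <= s ->
  heat_pairing f f s = l2norm (T (s / 2) f) ^+ 2.
Proof.
move=> ef s0; rewrite /heat_pairing ger0_norm// -{2}(T0 ef) pairing_half//.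
by rewrite addr0.
Qed.

Lemma heat_pairing_ge0 f s : ell2 f -> 0 <= heat_pairing f f s.
Proof.
move=> ef; rewrite (_ : heat_pairing f f s = heat_pairing f f `|s|).
  by rewrite pairing_sq// sqr_ge0.
by rewrite /heat_pairing normr_id.
Qed.

Lemma heat_pairing_decreasing f s t : ell2 f -> 0 <= s -> s <= t ->
  heat_pairing f f t <= heat_pairing f f s.
Proof.
move=> ef s0 st; have t0 := le_trans s0 st; rewrite !pairing_sq//.
rewrite ler_pXn2r ?nnegrE ?l2norm_ge0//.
rewrite (_ : t / 2 = (t - s) / 2 + s / 2); last by rewrite -mulrDl subrK.
rewrite T_add ?divr_ge0 ?subr_ge0//; apply: T_contr; first by rewrite divr_ge0// subr_ge0.
by apply: T_ell2 => //; rewrite divr_ge0.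
Qed.

Let formD0_fin n phi : supp_ball b o n phi -> formD0 b c o phi /\ ell2 phi.
Proof.
move=> sphi; split; last first.
  by apply: ell2_seq (ball_seq_uniq b o n) _ => x; exact: supp_ball_notin.
split; first exact: Qform_fin hgraph hconn hfin _ _ sphi.
move=> e e0; exists phi; split; first exact: finite_supp_ball sphi.
rewrite (_ : (fun x => phi x - phi x) = (fun=> 0)); last first.
  by apply/funext => x; rewrite subrr.
have s0 : supp_ball b o 0 (fun _ : X => 0 : R) by [].
rewrite (Qform_Qbil hgraph (Qform_fin hgraph hconn hfin s0)).
rewrite (Qbil_fin hgraph hconn hfin _ s0) big1; last by move=> x _; rewrite mul0r.
by rewrite subrr normr0 expr0n/= adde0 lte_fin exprn_gt0.
Qed.

(** The two cross terms agree by symmetry of [T]. The factor [1 *] gives the sum the shape of the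
    linearity axiom. *)
Lemma heat_pairing_polarization f g s : ell2 f -> ell2 g ->
  heat_pairing (fun x => 1 * f x + g x) (fun x => 1 * f x + g x) s -
  heat_pairing (fun x => f x - g x) (fun x => f x - g x) s =
  4 * heat_pairing g f s.
Proof.
move=> ef eg; have s0 : 0 <= `|s| by [].
have [[_ lin _ _] _ _ _ _] := hT.
have eTf : ell2 (T `|s| f) by exact: T_ell2.
have eTg : ell2 (T `|s| g) by exact: T_ell2.
have eD : ell2 (fun x => 1 * f x + g x) by exact: ell2D.
have eB : ell2 (fun x => f x - g x) by exact: ell2_sub.
rewrite /heat_pairing T_sub// lin// l2innerBl// l2innerDl// !l2innerBr//.
rewrite (l2innerC (T `|s| f)) (l2innerC (T `|s| g)) !l2innerDl//.
rewrite (l2innerC f) (l2innerC g) (l2innerC f) (l2innerC g).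
rewrite (T_sym s0 ef eg) (l2innerC f); ring.
Qed.

Lemma heat_pairing_scale (a : R) f g s : ell2 f -> ell2 g ->
  heat_pairing (fun x => a * g x) (fun x => a * f x) s =
  a ^+ 2 * heat_pairing g f s.
Proof.
move=> ef eg; have s0 : 0 <= `|s| by [].
have [eaf eag] := (ell2Z a ef, ell2Z a eg).
rewrite /heat_pairing l2innerC l2innerZl//; last exact: T_ell2.
rewrite l2innerC T_sym// l2innerZl//; last exact: T_ell2.
by rewrite -T_sym// mulrA.
Qed.

(** * Variational bounds for the truncated potential energy *)

Section PotentialEnergy.
Variables (f : X -> R) (m : nat).
Hypothesis sf : supp_ball b o m f.

Let ef : ell2 f. Proof. exact: (formD0_fin sf).2. Qed.

Local Notation E N := (int0 N (heat_pairing f f)).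
Local Notation w N := (heat_integral N f).

Let heat_integral_form N : 0 <= N -> formD0 b c o (w N).
Proof. by move=> N0; have [] := heat_integral_is_L N0 ef. Qed.

Let heat_integral_weak N h : 0 <= N -> formD0 b c o h -> ell2 h ->
  Qbil b c (w N) h = l2inner f h - l2inner (T N f) h.
Proof.
move=> N0 Dh eh; have [_ _ _ ->//] := heat_integral_is_L N0 ef.
by rewrite l2innerBl//; exact: T_ell2.
Qed.

(** Testing the weak equation with w_N itself, the defect is the integral of <T_s f, T_N f>,
    nonnegative by [pairing_half]. *)
Let heat_integral_energy N : 0 <= N -> Qbil b c (w N) (w N) <= E N.
Proof.
move=> N0; have ew := heat_integral_ell2 N0 ef.
rewrite heat_integral_weak//; last exact: heat_integral_form.
rewrite (l2innerC f) (l2innerC (T N f)) !heat_integral_pairing//; last exact: T_ell2.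
rewrite lerBlDr lerDl; apply: int0_ge0 => s s0 _.
by rewrite /heat_pairing ger0_norm// pairing_half// sqr_ge0.
Qed.

Lemma potential_lower N n phi : 0 <= N -> supp_ball b o n phi ->
  2 * l2inner phi f - Qbil b c phi phi - 2 * l2inner (T N f) phi <= E N.
Proof.
move=> N0 sphi; have [Dphi ephi] := formD0_fin sphi.
apply: le_trans (heat_integral_energy N0).
have := Qbil_young hgraph (heat_integral_form N0).1 Dphi.1.
by rewrite heat_integral_weak// (l2innerC phi); lra.
Qed.

(** The term <T_N f, phi> in [potential_lower] vanishes in the limit: since [heat_pairing f f] is
    nonincreasing, [2 * N * l2norm (T N f) ^+ 2] is at most the integral up to [2 * N], hence at
    most [M]. *)
Lemma potential_lower_sup (M : R) n phi : (forall N, 0 <= N -> E N <= M) ->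
  supp_ball b o n phi -> 2 * l2inner phi f - Qbil b c phi phi <= M.
Proof.
move=> EM sphi; have [Dphi ephi] := formD0_fin sphi.
rewrite leNgt; apply/negP; rewrite -subr_gt0.
set e := _ - M => e0.
have M0 : 0 <= M.
  by apply: le_trans (EM 0 (lexx _)); apply: int0_ge0 => s _ _; exact: heat_pairing_ge0.
(* If the claim failed by [e], then [e <= 2 * l2norm (T N f) * l2norm phi], and the decay bound
   would give [N * e ^+ 2 <= C]; N is chosen so that [N * e ^+ 2 = C + 1]. *)
pose C := 4 * l2norm phi ^+ 2 * M.
have C0 : 0 <= C by apply: mulr_ge0 => //; apply: mulr_ge0 => //; exact: sqr_ge0.
pose N := (C + 1) / e ^+ 2.
have N0 : 0 < N by rewrite divr_gt0 ?exprn_gt0//; lra.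
have decay : 2 * N * l2norm (T N f) ^+ 2 <= M.
  have N2 : 0 <= 2 * N by rewrite mulr_ge0// ltW.
  apply: le_trans (EM _ N2).
  have -> : l2norm (T N f) ^+ 2 = heat_pairing f f (2 * N).
    by rewrite pairing_sq//; congr (l2norm (T _ f) ^+ 2); field.
  rewrite mulrC -(int0_cst _ N2).
  have c1 : continuous (fun s => heat_pairing f f s) by exact: heat_pairing_continuous.
  rewrite /int0; apply: le_Rintegral => //.
  - by apply: int0_integrable => s; exact: cst_continuous.
  - exact: int0_integrable.
  - by move=> s /=; rewrite in_itv/= => /andP[? ?]; exact: heat_pairing_decreasing.
have eT : ell2 (T N f) by apply: T_ell2 => //; exact: ltW.
have := potential_lower (ltW N0) sphi; have := EM N (ltW N0).
have := l2_cauchy_schwarz eT ephi; rewrite ler_norml => /andP[_].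
have := l2norm_ge0 (T N f); have := l2norm_ge0 phi.
have Ne : N * e ^+ 2 = C + 1 by rewrite /N divfK// expf_neq0// gt_eqF.
have eE : 2 * l2inner phi f - Qbil b c phi phi = M + e by rewrite /e; ring.
rewrite eE; move: Ne decay; rewrite /C.
move: (l2norm (T N f)) (l2norm phi) (l2inner _ phi) (E N) => a d z EN.
move=> Ne decay d0 a0 zad ENM low.
have ead : e <= 2 * (a * d) by lra.
have e2 : e ^+ 2 <= 4 * (a * d) ^+ 2.
  have := lexx e; rewrite (_ : 4 * (a * d) ^+ 2 = (2 * (a * d)) ^+ 2); last by ring.
  by move=> _; rewrite ler_pXn2r// nnegrE ?mulr_ge0// ltW.
have h1 : N * e ^+ 2 <= N * (4 * (a * d) ^+ 2) by rewrite ler_wpM2l// ltW.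
have h2 : N * (4 * (a * d) ^+ 2) = 2 * d ^+ 2 * (2 * N * a ^+ 2) by ring.
have h3 : 2 * d ^+ 2 * (2 * N * a ^+ 2) <= 2 * d ^+ 2 * M.
  by rewrite ler_wpM2l// mulr_ge0// sqr_ge0.
have h4 : 0 <= d ^+ 2 * M by rewrite mulr_ge0// sqr_ge0.
by move: h1; rewrite Ne h2; lra.
Qed.

(** Since Q(w_N) <= E(N) = <w_N, f>, one has E(N) <= 2 <w_N, f> - Q(w_N). As w_N lies in [formD0],
    it can be replaced by a finitely supported function at a cost proportional to [eta]. *)
Lemma potential_upper N (M : R) : 0 <= N ->
  (forall n phi, supp_ball b o n phi ->
     2 * l2inner phi f - Qbil b c phi phi <= M) -> E N <= M.
Proof.
move=> N0 phiM; have ew := heat_integral_ell2 N0 ef.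
have [Qw approx] := heat_integral_form N0.
have us := ball_seq_uniq b o m.
have fs x : x \notin ball_seq b o m -> f x = 0 by exact: supp_ball_notin.
have [C C0 hC] := energy_pairing o hgraph hconn (ball_seq b o m) f.
set W := w N in ew Qw approx.
have EW : E N = l2inner W f by rewrite heat_integral_pairing.
have QE : Qbil b c W W <= E N by exact: heat_integral_energy.
have Q0 := Qbil_ge0 hgraph W.
(* The three costs: [2 * C] from the pairing, Q(W) from the factor 1 + eta in [Qbil_triangle], and 2
   from its last term. *)
pose K := 2 * C + Qbil b c W W + 2.
have K0 : 0 < K by rewrite /K; lra.
have key (eta : R) : 0 < eta -> eta <= 1 -> E N <= M + K * eta.
  move=> eta0 eta1; have [phi [fphi]] := approx eta eta0.
  set v := fun x => W x - phi x => small.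
  have [n sphi] := supp_ball_finite b o fphi.
  have Qphi := Qform_fin hgraph hconn hfin sphi.
  have Qv : (Qform b c v < +oo)%E.
    apply: le_lt_trans (lt_trans small (ltry _)); by rewrite leeDl.
  move: small; rewrite Qform_Qbil// -EFinD lte_fin real_normK ?num_real// -/(v o).
  move=> /ltW small; have := hC v eta (ltW eta0) Qv small.
  have -> : \sum_(x <- ball_seq b o m) v x * f x = l2inner W f - l2inner phi f.
    rewrite !(l2inner_seq _ us fs) -sumrB; apply: eq_bigr => x _.
    by rewrite /v; ring.
  rewrite -EW ler_norml => /andP[_ pair].
  have tri := Qbil_triangle hgraph eta0 Qw Qphi Qv; rewrite -/v in tri.
  have := phiM n phi sphi; move: tri QE.
  have smallv : (1 + eta^-1) * Qbil b c v v <= 2 * eta.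
    have i0 : 0 < eta^-1 by rewrite invr_gt0.
    apply: (@le_trans _ _ ((1 + eta^-1) * eta ^+ 2)).
      rewrite ler_wpM2l//; first by lra.
      by have := sqr_ge0 (v o); lra.
    rewrite mulrDl mul1r expr2 mulrA mulVf ?mul1r; last by rewrite gt_eqF.
    by nra.
  move: smallv pair; rewrite /K.
  move: (Qbil b c v v) (Qbil b c phi phi) (Qbil b c W W) (l2inner phi f) (E N) (eta^-1).
  move=> qv qp qW pf EN ie smallv pair tri QE low.
  by nra.
rewrite leNgt; apply/negP => ME.
(* At [eta = d] the error is half of the supposed gap. If [d > 1], the value [eta = 1] already gives
   a contradiction. *)
pose d := (E N - M) / (2 * K).
have d0 : 0 < d by rewrite divr_gt0 ?subr_gt0// mulr_gt0.
have Kd : K * d = (E N - M) / 2 by rewrite /d; field; rewrite gt_eqF.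
have [d1|/ltW d1] := leP d 1.
  by have := key d d0 d1; rewrite Kd; lra.
have := key 1 ltr01 (lexx _); rewrite mulr1.
have : K <= K * d by rewrite ler_peMr// ltW.
by rewrite Kd; lra.
Qed.

End PotentialEnergy.

End HeatSemigroup.

(** * The Green function *)

Section GreenFunction.
Context {R : realType} {X : countType} (b : X -> X -> R) (c : X -> R) (o : X).
Hypotheses (hgraph : is_graph b c) (hconn : connected_graph b).
Hypothesis hfin : forall n, finite_set (gball b o n).
Variable T : R -> (X -> R) -> X -> R.
Hypothesis hT : is_heat_semigroup b c o T.
Implicit Types (f g h phi : X -> R).

Let bC x y : b x y = b y x. Proof. by case: hgraph. Qed.

Definition total_energy f : \bar R :=
  \int[lebesgue_measure]_(s in `[0%R, +oo[) (heat_pairing T f f s)%:E.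

Let ell2_supp n f : supp_ball b o n f -> ell2 f.
Proof.
by move=> sf; apply: ell2_seq (ball_seq_uniq b o n) _ => x; exact: supp_ball_notin.
Qed.

Let pairing_cont f g : ell2 f -> ell2 g -> continuous (heat_pairing T f g).
Proof. exact: heat_pairing_continuous hT _ _. Qed.

Let pairing_ge0 f s : ell2 f -> 0 <= heat_pairing T f f s.
Proof. exact: heat_pairing_ge0 hT _ _. Qed.

Lemma total_energy_upper m f (M : R) : supp_ball b o m f ->
  (forall n phi, supp_ball b o n phi ->
     2 * l2inner phi f - Qbil b c phi phi <= M) -> (total_energy f <= M%:E)%E.
Proof.
move=> sf phiM; have ef := ell2_supp sf; apply: integral_ge0_sup.
- exact: pairing_cont.
- by move=> s _; exact: pairing_ge0.
- by move=> N N0; rewrite lee_fin; exact: (potential_upper hgraph hconn hfin hT sf N0 phiM).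
Qed.

Lemma total_energy_lower m f n phi : supp_ball b o m f -> supp_ball b o n phi ->
  ((2 * l2inner phi f - Qbil b c phi phi)%:E <= total_energy f)%E.
Proof.
move=> sf sphi; have ef := ell2_supp sf.
have pos N : ((int0 N (heat_pairing T f f))%:E <= total_energy f)%E.
  by apply: le_int0_integral; [exact: pairing_cont|move=> s _; exact: pairing_ge0].
have [->|noty] := eqVneq (total_energy f) +oo%E; first exact: leey.
have finE : total_energy f \is a fin_num.
  rewrite ge0_fin_numE ?ltey//.
  by apply: integral_ge0 => s _; rewrite lee_fin pairing_ge0.
rewrite -(fineK finE) lee_fin.
apply: (potential_lower_sup hgraph hconn hfin hT sf _ sphi) => N N0.
by rewrite -lee_fin (fineK finE); exact: pos.
Qed.

Lemma total_energy_cvg m f (h : nat -> X -> R) : supp_ball b o m f ->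
  (forall n, supp_ball b o n (h n)) ->
  (forall n x, (gdist b x o <= n)%N -> Lapl b c (h n) x = f x) ->
  (l2inner (h n) f)%:E @[n --> \oo] --> total_energy f.
Proof.
move=> sf sh Lh.
have inner n phi : supp_ball b o n phi ->
    \sum_(x <- ball_seq b o n) phi x * f x = l2inner phi f.
  move=> sphi; rewrite l2innerC (l2inner_seq _ (ball_seq_uniq b o n)).
    by apply: eq_bigr => x _; rewrite mulrC.
  by move=> x; exact: supp_ball_notin.
have upper n phi : supp_ball b o n phi ->
    2 * l2inner phi f - Qbil b c phi phi <= l2inner (h n) f.
  move=> sphi; rewrite -!(inner n)//.
  exact: (dirichlet_variational hgraph hconn hfin (sh n) (Lh n)).
have self n : 2 * l2inner (h n) f - Qbil b c (h n) (h n) = l2inner (h n) f.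
  by rewrite (dirichlet_energy hgraph hconn hfin (sh n) (Lh n)) inner//; ring.
have nd : {homo (fun n => (l2inner (h n) f)%:E) : n m / (n <= m)%N >-> (n <= m)%E}.
  move=> n p np; rewrite lee_fin -{1}self; apply: upper.
  exact: supp_ballW np (sh n).
have -> : total_energy f = ereal_sup (range (fun n => (l2inner (h n) f)%:E)).
  apply/eqP; rewrite eq_le; apply/andP; split; last first.
    apply: ge_ereal_sup => _ [n _ <-]; rewrite -self.
    exact: total_energy_lower sf (sh n).
  have ub n : ((l2inner (h n) f)%:E <= ereal_sup (range (fun n => (l2inner (h n) f)%:E)))%E.
    by apply: ereal_sup_ubound; exists n.
  case: (ereal_sup _) ub => [M| |] ub.
  - apply: (total_energy_upper sf) => n phi sphi.
    by apply: le_trans (upper _ _ sphi) _; rewrite -lee_fin.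
  - exact: leey.
  - by have := ub 0%N; rewrite leeNy_eq.
exact: ereal_nondecreasing_cvgn.
Qed.

Let del (x y : X) : R := (y == x)%:R.

Let supp_del n x : (gdist b x o <= n)%N -> supp_ball b o n (del x).
Proof.
move=> xn y ny; rewrite /del; case: eqP => // yx.
by move: ny; rewrite yx ltnNge xn.
Qed.

Let del_ell2 x : ell2 (del x) := ell2_del x.

(** The halves cancel the factor 4 of the polarization identity, and the [1 *] matches its form. *)
Let fplus x y (z : X) : R := 1 * (2^-1 * del x z) + 2^-1 * del y z.
Let fminus x y (z : X) : R := 2^-1 * del x z - 2^-1 * del y z.

Let supp_fplus x y :
  supp_ball b o (maxn (gdist b x o) (gdist b y o)) (fplus x y).
Proof.
move=> z zn; rewrite /fplus (supp_del (leq_maxl _ _) zn).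
by rewrite (supp_del (leq_maxr _ _) zn); ring.
Qed.

Let supp_fminus x y :
  supp_ball b o (maxn (gdist b x o) (gdist b y o)) (fminus x y).
Proof.
move=> z zn; rewrite /fminus (supp_del (leq_maxl _ _) zn).
by rewrite (supp_del (leq_maxr _ _) zn); ring.
Qed.

Let inner_fplus x y g : ell2 g -> l2inner g (fplus x y) = 2^-1 * (g x + g y).
Proof.
move=> eg; rewrite l2innerC l2innerDl//; try exact: ell2Z.
by rewrite !l2innerZl// !(l2innerC _ g) !l2inner_del; ring.
Qed.

Let inner_fminus x y g : ell2 g -> l2inner g (fminus x y) = 2^-1 * (g x - g y).
Proof.
move=> eg; rewrite l2innerC l2innerBl//; try exact: ell2Z.
by rewrite !l2innerZl// !(l2innerC _ g) !l2inner_del; ring.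
Qed.

(** Pairing with [fminus x y] sees only the difference of two values, whose square is at most [C]
    times the energy; hence the difference minus the energy is at most [C]. *)
Lemma total_energy_fminus x y : total_energy (fminus x y) \is a fin_num.
Proof.
have em := ell2_supp (@supp_fminus x y).
rewrite ge0_fin_numE; last by apply: integral_ge0 => s _; rewrite lee_fin pairing_ge0.
have [C C0 hC] := energy_difference hgraph hconn x y.
apply: (@le_lt_trans _ _ C%:E); last exact: ltry.
apply: (total_energy_upper (@supp_fminus x y)) => n phi sphi.
rewrite inner_fminus; last exact: ell2_supp sphi.
have := hC phi (Qform_fin hgraph hconn hfin sphi); have := Qbil_ge0 hgraph phi.
move: (Qbil b c phi phi) (phi x - phi y) => Q d Q0 dQ.
have dC : d <= C + Q by nra.
by lra.
Qed.

(* As total_energy (fminus x y) is finite, the difference makes sense even when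
   the graph is recurrent. *)
Lemma Green_polarization x y :
  Green T x y = (total_energy (fplus x y) - total_energy (fminus x y))%E.
Proof.
have ep := ell2_supp (@supp_fplus x y); have em := ell2_supp (@supp_fminus x y).
rewrite /total_energy -integral_sub_ge0.
- apply: eq_integral => t /set_mem /=; rewrite in_itv/= andbT => t0; congr EFin.
  rewrite (heat_pairing_polarization hT); try exact: ell2Z.
  rewrite (heat_pairing_scale hT)// (_ : \1_[set y] = del y); last first.
    apply/funext => z; rewrite indicE /del; congr (_%:R); congr nat_of_bool.
    by apply/idP/eqP => [/set_mem//|->]; exact: mem_set.
  by rewrite /heat_pairing l2inner_del ger0_norm//; field.
- exact: pairing_cont.
- exact: pairing_cont.
- by move=> s; exact: pairing_ge0.
- by move=> s; exact: pairing_ge0.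
- by have := total_energy_fminus x y; rewrite fin_numElt => /andP[].
Qed.

(** Constants are finitely supported and have zero energy here, so 2 <phi, fplus> - Q(phi) is
    unbounded. *)
Lemma Green_infinite x y n : (forall z, c z = 0) ->
  (forall z, (gdist b z o <= n)%N) -> Green T x y = +oo%E.
Proof.
move=> c0 allz; rewrite Green_polarization.
have -> : total_energy (fplus x y) = +oo%E.
  apply/eqyP => M M0.
  have s1 : supp_ball b o n (fun=> M) by move=> z; rewrite ltnNge allz.
  have := total_energy_lower (@supp_fplus x y) s1.
  rewrite (Qbil_fin hgraph hconn hfin _ s1) big1; last first.
    by move=> z _; rewrite (Lapl_cst hgraph hconn hfin) c0 mul0r mulr0.
  rewrite inner_fplus; last exact: ell2_supp s1.
  by apply: le_trans; rewrite lee_fin; lra.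
by rewrite addye//; move: (total_energy_fminus x y); case: (total_energy _).
Qed.

Hypothesis nd : forall n, nondegenerate_ball b c o n.

Variable g : nat -> X -> X -> R.
Hypothesis sg : forall n y, supp_ball b o n (g n y).
Hypothesis Lg : forall n y x, (gdist b x o <= n)%N -> Lapl b c (g n y) x = del y x.

(** By Green's formula Q(g_u, g_v) is the value of g_v at u, and the form is symmetric. For a pole
    outside the ball both sides are 0. *)
Let g_sym n x y : g n x y = g n y x.
Proof.
have E u v : Qbil b c (g n u) (g n v) = g n v u.
  rewrite (Qbil_fin hgraph hconn hfin _ (@sg n v)).
  rewrite (_ : \sum_(z <- _) _ = \sum_(z <- ball_seq b o n) g n v z * (u == z)%:R).
    rewrite sum_seq_delta ?ball_seq_uniq//; case: ifPn => // un.
    by rewrite (supp_ball_notin hfin (@sg n v) un).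
  by apply: eq_big_seq => z; rewrite mem_ball_seq// => zn; rewrite Lg// /del eq_sym.
rewrite -!E /Qbil; congr (_ * _ + _); apply: eq_rsum => p; ring.
Qed.

(** Since g is symmetric, it obeys the same polarization identity as [Green]. The two pieces
    converge separately, and the finite limit for [fminus] makes the subtraction legitimate. *)
Lemma Green_cvg x y : (g n y x)%:E @[n --> \oo] --> Green T x y.
Proof.
have cvgP := total_energy_cvg
  (h := fun n z => 1 * (2^-1 * g n x z) + 2^-1 * g n y z) (@supp_fplus x y).
have cvgM := total_energy_cvg
  (h := fun n z => 2^-1 * g n x z - 2^-1 * g n y z) (@supp_fminus x y).
rewrite Green_polarization.
have scale n u z (a : R) : Lapl b c (fun z => a * g n u z) z = a * Lapl b c (g n u) z.
  rewrite (_ : (fun z => a * g n u z) = (fun z => a * g n u z + (fun=> 0) z)).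
    by rewrite (LaplD hgraph hconn hfin) (Lapl_cst hgraph hconn hfin) mulr0 addr0.
  by apply/funext => v; rewrite addr0.
have suppP n : supp_ball b o n (fun z => 1 * (2^-1 * g n x z) + 2^-1 * g n y z).
  by move=> z zn; rewrite !sg//; ring.
have suppM n : supp_ball b o n (fun z => 2^-1 * g n x z - 2^-1 * g n y z).
  by move=> z zn; rewrite !sg//; ring.
have E n : (g n y x)%:E =
    ((l2inner (fun z => (1 * (2^-1 * g n x z) + 2^-1 * g n y z)%R) (fplus x y))%:E -
     (l2inner (fun z => (2^-1 * g n x z - 2^-1 * g n y z)%R) (fminus x y))%:E)%E.
  rewrite inner_fplus ?inner_fminus; [|exact: ell2_supp (suppM n)|exact: ell2_supp (suppP n)].
  by rewrite -EFinB (g_sym n x y); congr EFin; field.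
have dP : (total_energy (fplus x y) +? - total_energy (fminus x y))%E.
  by rewrite fin_num_adde_defl// fin_numN total_energy_fminus.
have LP n z : (gdist b z o <= n)%N ->
    Lapl b c (fun z => 1 * (2^-1 * g n x z) + 2^-1 * g n y z) z = fplus x y z.
  by move=> zn; rewrite (LaplD hgraph hconn hfin) !scale !Lg.
have LM n z : (gdist b z o <= n)%N ->
    Lapl b c (fun z => 2^-1 * g n x z - 2^-1 * g n y z) z = fminus x y z.
  by move=> zn; rewrite (LaplB hgraph hconn hfin) !scale !Lg.
under eq_fun do rewrite E.
exact: cvgeB dP (cvgP suppP LP) (cvgM suppM LM).
Qed.

Let g_ge0 n y x : 0 <= g n y x.
Proof.
apply: (maximum_principle hgraph hconn hfin (nd n)) => z zn.
  by rewrite Lg// /del ler0n.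
by rewrite sg.
Qed.

Let g_nondecreasing y x m n : (m <= n)%N -> g m y x <= g n y x.
Proof.
move=> mn; rewrite -subr_ge0.
have := maximum_principle hgraph hconn hfin (phi := fun x => g n y x - g m y x) (nd m).
apply=> z zm; last by rewrite (@sg _ _ _ zm) subr0 g_ge0.
by rewrite (LaplB hgraph hconn hfin) !Lg ?subrr//; exact: leq_trans mn.
Qed.

Lemma le_Green n x y : ((g n y x)%:E <= Green T x y)%E.
Proof.
apply: (cvge_ge _ (@Green_cvg x y)); exists n => // m nm /=.
by rewrite lee_fin g_nondecreasing.
Qed.

(** * Green potentials from Dirichlet problems on balls *)

Section GreenPotential.
Variables (h : X -> R) (w : nat -> X -> R).
Hypothesis h0 : forall x, 0 <= h x.
Hypothesis sw : forall n, supp_ball b o n (w n).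
Hypothesis Lw : forall n x, (gdist b x o <= n)%N -> Lapl b c (w n) x = h x.

Let Lsum n (s : seq X) x : uniq s -> (gdist b x o <= n)%N ->
  Lapl b c (fun z => \sum_(y <- s) h y * g n y z) x = if x \in s then h x else 0.
Proof.
move=> us xn; rewrite (Lapl_sum hgraph hconn hfin) -sum_seq_delta//.
by apply: eq_bigr => y _; rewrite Lg.
Qed.

(** By uniqueness [w n] is the sum of [h y * g n y x] over the ball, and g lies below [Green]. *)
Lemma Green_op_ge n x : ((w n x)%:E <= Green_op T h x)%E.
Proof.
have -> : w n x = \sum_(y <- ball_seq b o n) h y * g n y x.
  apply/eqP; rewrite -subr_eq0; apply/eqP.
  have := maximum_principle0 hgraph hconn hfin
    (phi := fun x => w n x - \sum_(y <- ball_seq b o n) h y * g n y x) (nd n).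
  apply=> z zn.
    by rewrite (LaplB hgraph hconn hfin) Lw// Lsum ?ball_seq_uniq// mem_ball_seq// zn subrr.
  by rewrite sw// big1 ?subr0// => y _; rewrite sg// mulr0.
have G0 y : (0 <= Green T x y)%E by apply: le_trans (le_Green 0 x y); rewrite lee_fin g_ge0.
apply: (@le_trans _ _ (\sum_(y <- ball_seq b o n) Green T x y * (h y)%:E)%E); last first.
  by apply: sum_le_esum; [exact: ball_seq_uniq|move=> y; rewrite mule_ge0// lee_fin].
rewrite -sumEFin; apply: lee_sum => y _; rewrite mulrC EFinM.
by apply: lee_wpmul2r; [rewrite lee_fin|exact: le_Green].
Qed.

(** By the maximum principle every finite partial sum of [h y * g n y x] lies below [w n x]; the
    bound survives the limit in n and then the supremum over partial sums. *)
Lemma Green_op_le (M : R) x : (forall n, w n x <= M) -> (Green_op T h x <= M%:E)%E.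
Proof.
move=> wM; apply: esum_le_bound => s us.
have C : (\sum_(y <- s) (g n y x)%:E * (h y)%:E)%E @[n --> \oo] -->
    (\sum_(y <- s) Green T x y * (h y)%:E)%E.
  apply: cvg_nnesum => y _.
    by apply: nearW => n; rewrite -EFinM lee_fin mulr_ge0.
  by apply: cvgeZr => //; exact: Green_cvg.
apply: (cvge_le _ C); apply: nearW => n.
under eq_bigr do rewrite -EFinM; rewrite sumEFin lee_fin.
apply: le_trans (wM n); rewrite -subr_ge0.
have := maximum_principle hgraph hconn hfin
    (phi := fun x => w n x - \sum_(y <- s) h y * g n y x) (nd n).
move=> /(_ _ _ x) mp; under eq_bigr do rewrite mulrC; apply: mp => z zn.
  rewrite (LaplB hgraph hconn hfin) Lw// Lsum//.
  by case: ifP; rewrite ?subrr ?subr0.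
by rewrite sw// big1 ?subr0// => y _; rewrite sg// mulr0.
Qed.

End GreenPotential.

End GreenFunction.

(** * Radial functions *)

Section RadialFunctions.
Context {R : realType} {X : countType} (b : X -> X -> R) (c : X -> R) (o : X).
Hypotheses (hgraph : is_graph b c) (hconn : connected_graph b).
Hypothesis hsym : weakly_spherically_symmetric b c o.

Let b0 x y : 0 <= b x y. Proof. by case: hgraph. Qed.
Let bC x y : b x y = b y x. Proof. by case: hgraph. Qed.
Let c0 x : 0 <= c x. Proof. by case: hgraph. Qed.

Let hminus x y : gdist b x o = gdist b y o -> bminus b o x = bminus b o y.
Proof. by move=> /hsym[]. Qed.

Lemma wss_ball_finite n : finite_set (gball b o n).
Proof. exact: ball_finite hgraph hconn hminus n. Qed.

Let sfin r : finite_set (gsphere b o r).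
Proof. exact: sphere_finite hgraph hconn hminus r. Qed.

Definition sphere_seq r : seq X := fset_set (gsphere b o r).

Lemma mem_sphere_seq r x : (x \in sphere_seq r) = (gdist b x o == r).
Proof.
rewrite in_fset_set//; apply/idP/eqP => [/set_mem//|?]; exact/mem_set.
Qed.

Let sum_ball_sphere r n (F : X -> R) : (r <= n)%N ->
  \sum_(y <- ball_seq b o n | gdist b y o == r) F y = \sum_(y <- sphere_seq r) F y.
Proof.
move=> rn; rewrite -big_filter; apply: perm_big; apply: uniq_perm.
- by rewrite filter_uniq// ball_seq_uniq.
- exact: fset_uniq.
- move=> y; rewrite mem_filter mem_ball_seq ?mem_sphere_seq; last exact: wss_ball_finite.
  by case: eqP => // ->.
Qed.

Definition sphere_flux r : R :=
  \sum_(x <- sphere_seq r) \sum_(y <- sphere_seq r.+1) b x y.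

Definition sphere_mass r : R := \sum_(x <- sphere_seq r) c x.

Definition ball_mass r : R := \sum_(k < r.+1) sphere_mass k.

Let bplusE x : bplus b o x = (\sum_(y <- sphere_seq (gdist b x o).+1) b x y)%:E.
Proof.
rewrite /bplus esum_fset; [|exact: sfin|by move=> *; rewrite lee_fin].
by rewrite fsbig_finite ?sumEFin//; exact: sfin.
Qed.

Let bminusE x r : gdist b x o = r.+1 ->
  bminus b o x = (\sum_(y <- sphere_seq r) b x y)%:E.
Proof.
move=> xr; rewrite /bminus xr.
rewrite (_ : [set y | _] = gsphere b o r); last first.
  by apply/seteqP; split=> y /=; [case|move=> ->].
rewrite esum_fset; [|exact: sfin|by move=> *; rewrite lee_fin].
by rewrite fsbig_finite ?sumEFin//; exact: sfin.
Qed.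

Lemma bplus_set_sphere r : bplus_set b o (gsphere b o r) = (sphere_flux r)%:E.
Proof.
rewrite /bplus_set esum_fset; [|exact: sfin|]; last first.
  by move=> x _; apply: esum_ge0 => y _; rewrite lee_fin.
rewrite fsbig_finite/=; last exact: sfin.
rewrite /sphere_flux -sumEFin; apply: eq_big_seq => x.
by rewrite mem_sphere_seq => /eqP <-.
Qed.

Lemma sphere_mass_ge0 r : 0 <= sphere_mass r.
Proof. exact: sumr_ge0. Qed.

Lemma ball_massS r : ball_mass r.+1 = ball_mass r + sphere_mass r.+1.
Proof. by rewrite /ball_mass big_ord_recr. Qed.

Lemma ball_mass0 : ball_mass 0 = sphere_mass 0.
Proof. by rewrite /ball_mass big_ord1. Qed.

Lemma ball_mass_ge0 r : 0 <= ball_mass r.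
Proof. by apply: sumr_ge0 => k _; exact: sphere_mass_ge0. Qed.

Lemma c_set_ball r : c_set c (gball b o r) = (ball_mass r)%:E.
Proof.
have bfin := wss_ball_finite.
rewrite /c_set esum_fset//; last by move=> *; rewrite lee_fin.
rewrite fsbig_finite//= sumEFin; congr EFin.
rewrite -[LHS]/(\sum_(i <- ball_seq b o r) c i) /ball_mass /sphere_mass.
under [RHS]eq_bigr => k _ do
  rewrite -(@sum_ball_sphere k r) ?big_mkcond// -1?ltnS//.
rewrite exchange_big/=; apply: eq_big_seq => x; rewrite mem_ball_seq// => xr.
rewrite (bigD1 (Ordinal (xr : gdist b x o < r.+1)%N))//= eqxx big1 ?addr0// => k kx.
by case: eqP => // xk; move: kx; rewrite -val_eqE/= xk eqxx.
Qed.

Lemma sphere_flux_ge0 r : 0 <= sphere_flux r.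
Proof. by apply: sumr_ge0 => x _; exact: sumr_ge0. Qed.

Lemma sphere_flux_gt0 r x : gdist b x o = r.+1 -> 0 < sphere_flux r.
Proof.
move=> xr; have [y bxy yr] := gdist_pred hgraph hconn xr.
have ys : y \in sphere_seq r by rewrite mem_sphere_seq yr.
have xs : x \in sphere_seq r.+1 by rewrite mem_sphere_seq xr.
rewrite /sphere_flux (bigD1_seq y)//=; last exact: fset_uniq.
rewrite ltr_wpDr//; first by apply: sumr_ge0 => z _; exact: sumr_ge0.
rewrite (bigD1_seq x)//=; last exact: fset_uniq.
by rewrite ltr_wpDr ?sumr_ge0// bC.
Qed.

Definition sphere_card r : R := (size (sphere_seq r))%:R.

Let sum_const_sphere r (F : X -> R) x : gdist b x o = r ->
  (forall y, gdist b y o = r -> F y = F x) ->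
  \sum_(y <- sphere_seq r) F y = sphere_card r * F x.
Proof.
move=> xr Fc; rewrite (eq_big_seq (fun=> F x)); last first.
  by move=> y; rewrite mem_sphere_seq => /eqP; exact: Fc.
by rewrite big_const_seq count_predT iter_addr_0 mulr_natl.
Qed.

Lemma sphere_card_gt0 r x : gdist b x o = r -> 0 < sphere_card r.
Proof.
move=> xr; rewrite ltr0n; have : x \in sphere_seq r by rewrite mem_sphere_seq xr.
by case: (sphere_seq r).
Qed.

Lemma sphere_massE r x : gdist b x o = r -> sphere_mass r = sphere_card r * c x.
Proof.
by move=> xr; apply: sum_const_sphere => // y yr; have [] := hsym (etrans yr (esym xr)).
Qed.

Let flux_out r x : gdist b x o = r ->
  sphere_flux r = sphere_card r * \sum_(y <- sphere_seq r.+1) b x y.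
Proof.
move=> xr; apply: (sum_const_sphere (F := fun x => \sum_(y <- sphere_seq r.+1) b x y)) => // y yr.
have [+ _ _] := hsym (etrans yr (esym xr)).
by rewrite !bplusE xr yr => -[].
Qed.

(** The weight between consecutive spheres is counted from the outer side, by symmetry of [b], so
    the same [sphere_flux] governs [bminus] here and [bplus] in [flux_out]. *)
Let flux_in r x : gdist b x o = r.+1 ->
  sphere_flux r = sphere_card r.+1 * \sum_(y <- sphere_seq r) b x y.
Proof.
move=> xr; rewrite /sphere_flux exchange_big/=.
under eq_bigr => y _ do (under eq_bigr => z _ do rewrite bC).
apply: (sum_const_sphere (F := fun x => \sum_(y <- sphere_seq r) b x y)) => // y yr.
have [_ + _] := hsym (etrans yr (esym xr)).
by rewrite (bminusE xr) (bminusE yr) => -[].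
Qed.

Definition radial_flux (F : nat -> R) r := sphere_flux r * (F r - F r.+1).

(** Multiplication by the number of vertices sums the equation over the sphere. The weights to both
    neighbouring spheres become values of [sphere_flux], and the Laplacian becomes a difference of
    fluxes. *)
Lemma radial_Lapl F r x : gdist b x o = r ->
  sphere_card r * Lapl b c (fun x => F (gdist b x o)) x =
  radial_flux F r - (if r is r'.+1 then radial_flux F r' else 0) +
  sphere_mass r * F r.
Proof.
move=> xr; rewrite (LaplE hgraph hconn wss_ball_finite (n := r.+1)); last by rewrite xr.
rewrite xr mulrDr mulrA -(sphere_massE xr); congr (_ + _).
(* Neighbours lie at distance r-1, r or r+1, and those at distance r contribute 0. For [r = 0] the
   second sum is empty, so the value [r.-1 = 0] does no harm. *)
have -> : \sum_(y <- ball_seq b o r.+1) b x y * (F r - F (gdist b y o)) =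
    \sum_(y <- ball_seq b o r.+1 | gdist b y o == r.+1) b x y * (F r - F r.+1) +
    \sum_(y <- ball_seq b o r.+1 | (gdist b y o).+1 == r) b x y * (F r - F r.-1).
  rewrite [X in _ = X + _]big_mkcond [X in _ = _ + X]big_mkcond -big_split/=.
  apply: eq_bigr => y _; case: eqP => [->|yr1].
    have -> : (r.+2 == r) = false by lia.
    by rewrite addr0.
  rewrite add0r; case: eqP => [yr2|yr2]; first by rewrite -yr2.
  have [->|bxy] := eqVneq (b x y) 0; first by rewrite mul0r.
  have := gdist_adj o hgraph hconn bxy; rewrite bC in bxy.
  have := gdist_adj o hgraph hconn bxy; rewrite xr => h1 h2.
  have -> : gdist b y o = r by lia.
  by rewrite subrr mulr0.
rewrite -!mulr_suml sum_ball_sphere// mulrDr mulrA -(flux_out xr).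
rewrite /radial_flux; congr (_ + _); case: r xr => [|r] xr.
  by rewrite big1 ?mul0r ?mulr0 ?oppr0.
under eq_bigl do rewrite eqSS.
by rewrite sum_ball_sphere 1?ltnW// mulrA -(flux_in xr)/=; ring.
Qed.

(* Second component: the flux of the radial harmonic function through the sphere. *)
Fixpoint radial_pair (r : nat) : R * R :=
  if r is r'.+1 then
    let p := radial_pair r' in
    let f := p.1 + p.2 / sphere_flux r' in
    (f, p.2 + sphere_mass r * f)
  else (1, sphere_mass 0).

Definition radial_sol r := (radial_pair r).1.
Let flux r := (radial_pair r).2.

(** One joint induction, because each bound feeds the other: a nonnegative flux keeps the solution
    above 1, which lets the flux grow at least as fast as the mass. *)
Lemma radial_sol_flux_ge r : 1 <= radial_sol r /\ ball_mass r <= flux r.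
Proof.
rewrite /radial_sol /flux; elim: r => [|r [IH1 IH2]] /=.
  by rewrite lexx ball_mass0.
set f := _ + _ / _; have f1 : 1 <= f.
  rewrite /f -[1]addr0 lerD// divr_ge0 ?sphere_flux_ge0//.
  exact: le_trans (ball_mass_ge0 r) IH2.
by split=> //; rewrite ball_massS lerD// ler_peMr// sphere_mass_ge0.
Qed.

Lemma radial_sol_ge1 r : 1 <= radial_sol r.
Proof. by have [] := radial_sol_flux_ge r. Qed.

Let flux_ge r : ball_mass r <= flux r.
Proof. by have [] := radial_sol_flux_ge r. Qed.

Lemma radial_solS r : radial_sol r.+1 = radial_sol r + flux r / sphere_flux r.
Proof. by []. Qed.

Let fluxS r : flux r.+1 = flux r + sphere_mass r.+1 * radial_sol r.+1.
Proof. by []. Qed.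

Lemma radial_sol_leS r : radial_sol r <= radial_sol r.+1.
Proof.
rewrite radial_solS lerDl divr_ge0 ?sphere_flux_ge0//.
exact: le_trans (ball_mass_ge0 r) (flux_ge r).
Qed.

Lemma radial_sol_le m n : (m <= n)%N -> radial_sol m <= radial_sol n.
Proof. by move=> mn; apply: (homo_leq lexx le_trans radial_sol_leS). Qed.

Lemma radial_flux_le r : flux r <= ball_mass r * radial_sol r.
Proof.
elim: r => [|r IH]; first by rewrite ball_mass0 mulr1.
rewrite fluxS ball_massS mulrDl lerD// (le_trans IH)//.
by rewrite ler_wpM2l ?ball_mass_ge0// radial_sol_leS.
Qed.

(** Real division: a vanishing [sphere_flux r] gives 0 here, whereas the extended quotient in the
    theorem may be infinite. The two agree when every sphere is nonempty. *)
Definition mass_flux_ratio r := ball_mass r / sphere_flux r.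

Lemma mass_flux_ratio_ge0 r : 0 <= mass_flux_ratio r.
Proof. by rewrite divr_ge0 ?ball_mass_ge0 ?sphere_flux_ge0. Qed.

Lemma radial_sol_lower n : 1 + \sum_(r < n) mass_flux_ratio r <= radial_sol n.
Proof.
elim: n => [|n IH]; first by rewrite big_ord0 addr0.
rewrite big_ord_recr/= addrA radial_solS lerD//.
by rewrite ler_wpM2r ?invr_ge0 ?sphere_flux_ge0.
Qed.

(** The flux is at most mass times solution, so one step multiplies by at most 1 + a_n <=
    exp(a_n). *)
Lemma radial_sol_upper n : radial_sol n <= expR (\sum_(r < n) mass_flux_ratio r).
Proof.
elim: n => [|n IH]; first by rewrite big_ord0 expR0.
have f0 : 0 <= radial_sol n by exact: le_trans (radial_sol_ge1 n).
rewrite big_ord_recr/= expRD radial_solS.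
apply: (@le_trans _ _ (radial_sol n * (1 + mass_flux_ratio n))).
  rewrite mulrDr mulr1 lerD2l /mass_flux_ratio mulrA.
  rewrite ler_wpM2r ?invr_ge0 ?sphere_flux_ge0//.
  by rewrite mulrC; exact: radial_flux_le.
apply: ler_pM => //; last exact: expR_ge1Dx.
by rewrite addr_ge0// mass_flux_ratio_ge0.
Qed.

Hypothesis infinite : forall r, exists x, gdist b x o = r.

Let flux_gt0 r : 0 < sphere_flux r.
Proof. by have [x] := infinite r.+1; exact: sphere_flux_gt0. Qed.

Let sol_gt0 r : 0 < radial_sol r.
Proof. exact: lt_le_trans (radial_sol_ge1 r). Qed.

Let sphere_flux_sol r : sphere_flux r * (radial_sol r.+1 - radial_sol r) = flux r.
Proof. by rewrite radial_solS addrC addKr mulrC divfK// gt_eqF. Qed.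

Lemma radial_sol_harmonic x : Lapl b c (fun x => radial_sol (gdist b x o)) x = 0.
Proof.
have := radial_Lapl radial_sol (erefl (gdist b x o)).
set r := gdist b x o; have N0 := sphere_card_gt0 (erefl r).
suff -> : radial_flux radial_sol r - (if r is r'.+1 then radial_flux radial_sol r' else 0) +
    sphere_mass r * radial_sol r = 0.
  by move/eqP; rewrite mulf_eq0 gt_eqF//= => /eqP.
have E k : radial_flux radial_sol k = - flux k.
  by rewrite -sphere_flux_sol /radial_flux -mulrN opprB.
rewrite !E; case: r {N0} => [|r]; last by rewrite E fluxS; ring.
by rewrite /flux/= /radial_sol/=; ring.
Qed.

(** The constant 1, whose Laplacian is [c], minus a multiple of the harmonic solution chosen to
    vanish at radius n+1. The maximum acts only beyond that radius and confines the support to the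
    ball. *)
Definition ball_profile n r := Num.max 0 (1 - radial_sol r / radial_sol n.+1).

Lemma ball_profileE n r : (r <= n.+1)%N ->
  ball_profile n r = 1 - radial_sol r / radial_sol n.+1.
Proof.
by move=> rn; rewrite /ball_profile max_r// subr_ge0 ler_pdivrMr// mul1r radial_sol_le.
Qed.

Lemma ball_profile_supp n : supp_ball b o n (fun x => ball_profile n (gdist b x o)).
Proof.
move=> x xn; rewrite /ball_profile max_l// subr_le0 ler_pdivlMr// mul1r.
exact: radial_sol_le.
Qed.

Lemma Lapl_ball_profile n x : (gdist b x o <= n)%N ->
  Lapl b c (fun x => ball_profile n (gdist b x o)) x = c x.
Proof.
have := radial_Lapl (ball_profile n) (erefl (gdist b x o)).
have := sphere_massE (erefl (gdist b x o)).
set r := gdist b x o => Cr E rn; have N0 := sphere_card_gt0 (erefl r).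
apply: (mulfI (lt0r_neq0 N0)); rewrite E -Cr.
(* The flux at [k] involves radius k+1 <= n+1, where the truncation is still inactive. *)
have PF k : (k <= n)%N -> radial_flux (ball_profile n) k = flux k / radial_sol n.+1.
  move=> kn; rewrite /radial_flux !ball_profileE ?ltnS//; last exact: leqW.
  by rewrite -sphere_flux_sol; ring.
rewrite PF// ball_profileE; last exact: leqW.
case: r rn {Cr E N0} => [|r] rn.
  by rewrite /flux/= /radial_sol/=; ring.
by rewrite PF ?(ltnW rn)// fluxS; ring.
Qed.

(** Its decrements are the ratios, so its flux through the sphere of radius k is exactly the mass of
    the ball of radius k. The sum is empty for r > n, which gives the Dirichlet condition. *)
Definition ball_potential n r := \sum_(r <= k < n.+1) mass_flux_ratio k.

End RadialFunctions.

(** * The potential of [c] in the graph without killing *)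

Section RadialPotential.
Context {R : realType} {X : countType} (b : X -> X -> R) (c : X -> R) (o : X).
Hypotheses (hgraph : is_graph b c) (hconn : connected_graph b).
Hypothesis hsym : weakly_spherically_symmetric b c o.
Hypothesis infinite : forall r, exists x, gdist b x o = r.

Lemma is_graph_no_killing : is_graph b (fun=> 0).
Proof. by case: hgraph => *; split. Qed.

Lemma wss_no_killing : weakly_spherically_symmetric b (fun=> 0) o.
Proof. by move=> x y /hsym[]. Qed.

Lemma Lapl_ball_potential n x : (gdist b x o <= n)%N ->
  Lapl b (fun=> 0) (fun x => ball_potential b c o n (gdist b x o)) x = c x.
Proof.
have := radial_Lapl is_graph_no_killing hconn wss_no_killing (ball_potential b c o n)
  (erefl (gdist b x o)).
have := sphere_massE hgraph hconn hsym (erefl (gdist b x o)).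
set r := gdist b x o => Cr E rn.
have N0 := sphere_card_gt0 hgraph hconn hsym (erefl r).
apply: (mulfI (lt0r_neq0 N0)); rewrite E -Cr.
have -> : sphere_mass b (fun=> 0) o r = 0 by rewrite /sphere_mass big1.
rewrite mul0r addr0.
have PF k : (k <= n)%N -> radial_flux b o (ball_potential b c o n) k = ball_mass b c o k.
  move=> kn; rewrite /radial_flux /ball_potential big_ltn ?ltnS// addrK.
  rewrite /mass_flux_ratio mulrC divfK// gt_eqF//.
  by have [z zk] := infinite k.+1; exact: (sphere_flux_gt0 hgraph hconn hsym zk).
rewrite PF//; case: r rn {Cr E N0} => [|r] rn; first by rewrite subr0 ball_mass0.
by rewrite PF ?(ltnW rn)// ball_massS addrAC subrr add0r.
Qed.

Lemma ball_potential_supp n : supp_ball b o n (fun x => ball_potential b c o n (gdist b x o)).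
Proof. by move=> x xn; rewrite /ball_potential big_geq. Qed.

End RadialPotential.

(** * The dichotomy *)

Lemma nneseries_infiniteP {R : realType} (a : nat -> R) : (forall r, 0 <= a r) ->
  (\sum_(0 <= r <oo) (a r)%:E = +oo)%E <->
  (forall M, exists n, M < \sum_(r < n) a r).
Proof.
move=> a0; have partial n : (\sum_(0 <= r < n) (a r)%:E = (\sum_(r < n) a r)%:E)%E.
  by rewrite sumEFin big_mkord.
split=> [sumy M|unbounded].
  apply: contrapT => /forallNP bounded.
  suff : (\sum_(0 <= r <oo) (a r)%:E <= M%:E)%E by rewrite sumy leye_eq.
  apply: lime_le; first by apply: is_cvg_nneseries => n _ _; rewrite lee_fin.
  by apply: nearW => n; rewrite partial lee_fin leNgt; exact/negP/bounded.
apply/eqyP => M _; have [n Mn] := unbounded M.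
apply: (@le_trans _ _ (\sum_(0 <= r < n) (a r)%:E)%E).
  by rewrite partial lee_fin ltW.
by apply: nneseries_lim_ge => r _; rewrite lee_fin.
Qed.

Lemma dirichlet_green_family {R : realType} {X : countType} (b : X -> X -> R)
    (c : X -> R) (o : X) : is_graph b c -> connected_graph b ->
    (forall n, finite_set (gball b o n)) ->
    (forall n, nondegenerate_ball b c o n) ->
  exists g : nat -> X -> X -> R, (forall n y, supp_ball b o n (g n y)) /\
    (forall n y x, (gdist b x o <= n)%N -> Lapl b c (g n y) x = (x == y)%:R).
Proof.
move=> hgraph hconn hfin nd.
have H n y := cid (dirichlet_problem hgraph hconn hfin (fun x => (x == y)%:R) (nd n)).
exists (fun n y => projT1 (H n y)); split=> [n y|n y x].
  by case: (projT2 (H n y)).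
by case: (projT2 (H n y)) => _; exact.
Qed.

Section Dichotomy.
Context {R : realType} {X : countType} (b : X -> X -> R) (c : X -> R) (o : X).
Hypotheses (hgraph : is_graph b c) (hconn : connected_graph b).
Hypothesis hsym : weakly_spherically_symmetric b c o.

Let c0 x : 0 <= c x. Proof. by case: hgraph. Qed.
Let hfin : forall n, finite_set (gball b o n) := wss_ball_finite hgraph hconn hsym.
Let hgraph0 : is_graph b (fun=> 0) := is_graph_no_killing hgraph.

Let Liouville := forall u : X -> R,
  bounded_on_graph u -> graph_harmonic b c u -> forall x, u x = 0.

Let series := (\sum_(0 <= r <oo)
  (c_set c (gball b o r) / bplus_set b o (gsphere b o r)))%E.

Let seriesE : series = (\sum_(0 <= r <oo) ((ball_mass b c o r)%:E / (sphere_flux b o r)%:E))%E.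
Proof.
by apply: eq_eseriesr => r _; rewrite (c_set_ball hgraph) // (bplus_set_sphere hgraph).
Qed.

(** * Vanishing killing term: all four properties fail *)

Section NoKilling.
Hypothesis c_eq0 : forall x, c x = 0.

Lemma not_Liouville_no_killing : ~ Liouville.
Proof.
move=> /(_ (fun=> 1)) H; have : (1 : R) = 0.
  apply: (H _ _ o); first by exists 1 => x; rewrite normr1.
  split=> [|x]; first exact: in_F_all hgraph hconn hfin _.
  by rewrite (Lapl_cst hgraph hconn hfin) c_eq0 mul0r.
by move/eqP; rewrite oner_eq0.
Qed.

Lemma series_no_killing : series = 0%E.
Proof.
(* Every numerator is 0, and the convention 0 / 0 = 0 covers the empty spheres of a finite graph. *)
rewrite seriesE eseries0// => r _ _; rewrite /ball_mass big1 ?mul0e// => k _.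
by rewrite /sphere_mass big1.
Qed.

Lemma Green_op_no_killing T x : Green_op T c x = 0%E.
Proof. by rewrite /Green_op esum1// => y _; rewrite c_eq0 mule0. Qed.

End NoKilling.

Section Killing.
Variable z : X.
Hypothesis cz : 0 < c z.

Let nd n : nondegenerate_ball b c o n. Proof. by left; exists z. Qed.

Lemma Green_op_killing_le1 T x : is_heat_semigroup b c o T -> (Green_op T c x <= 1)%E.
Proof.
move=> hT; have [g [sg Lg]] := dirichlet_green_family hgraph hconn hfin nd.
have H n := cid (dirichlet_problem hgraph hconn hfin c (nd n)).
apply: (Green_op_le hgraph hconn hfin hT nd sg Lg c0 (w := fun n => projT1 (H n))).
- by move=> n; case: (projT2 (H n)).
- by move=> n; case: (projT2 (H n)).
- move=> n; case: (projT2 (H n)) => sw Lw; rewrite -subr_ge0.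
  have := maximum_principle hgraph hconn hfin (phi := fun x => 1 - projT1 (H n) x) (nd n).
  apply=> y yn; last by rewrite sw// subr0.
  by rewrite (LaplB hgraph hconn hfin) (Lapl_cst hgraph hconn hfin) Lw// mulr1 subrr.
Qed.

(** * Finite graph with killing: all four properties hold *)

Section FiniteGraph.
Variable m : nat.
Hypothesis bounded : forall x, (gdist b x o <= m)%N.

Lemma Liouville_finite : Liouville.
Proof.
move=> u _ [_ Lu]; apply: (maximum_principle0 hgraph hconn hfin (nd m)) => [x _|x].
  exact: Lu.
by rewrite ltnNge bounded.
Qed.

Lemma series_finite : series = +oo%E.
Proof.
apply/eqP; rewrite -leye_eq.
have term_ge0 r : (0 <= (ball_mass b c o r)%:E / (sphere_flux b o r)%:E)%E.
  by rewrite mule_ge0 ?inve_ge0 ?lee_fin ?(ball_mass_ge0 o hgraph) ?(sphere_flux_ge0 o hgraph).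
(* No vertex lies at distance m+1, so the denominator is 0, while the ball contains [z] and has
   positive mass: one term is infinite by the convention for a / 0. *)
have termm : ((ball_mass b c o m)%:E / (sphere_flux b o m)%:E = +oo)%E.
  have -> : sphere_flux b o m = 0.
    rewrite /sphere_flux big1_seq// => x _; rewrite big1_seq// => y /andP[_].
    rewrite (mem_sphere_seq hgraph)// => /eqP ym.
    by have := bounded y; rewrite ym ltnn.
  rewrite inve0 gt0_muley// lte_fin; apply: (@lt_le_trans _ _ (c z)) => //.
  have -> : ball_mass b c o m = fine (c_set c (gball b o m)) by rewrite (c_set_ball hgraph).
  rewrite -lee_fin fineK; last by rewrite (c_set_ball hgraph).
  apply: esum_ge; exists [set z]; last by rewrite fsbig_set1.
  by split; [exact: finite_set1|move=> _ -> /=; exact: bounded].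
rewrite seriesE; apply: (@le_trans _ _
  (\sum_(0 <= r < m.+1) ((ball_mass b c o r)%:E / (sphere_flux b o r)%:E))%E).
  rewrite big_nat_recr//= termm addey// gt_eqF// (lt_le_trans ltNy0)//.
  by apply: sume_ge0.
by apply: nneseries_lim_ge => r _.
Qed.

(** The ball of radius m is the whole graph, so the boundary condition is empty and the constant 1
    solves the Dirichlet problem for [c]. *)
Lemma Green_op_finite T x : is_heat_semigroup b c o T -> Green_op T c x = 1%E.
Proof.
move=> hT; apply/eqP; rewrite eq_le Green_op_killing_le1//=.
have [g [sg Lg]] := dirichlet_green_family hgraph hconn hfin nd.
have H n := cid (dirichlet_problem hgraph hconn hfin c (nd n)).
have ge n y : ((projT1 (H n) y)%:E <= Green_op T c y)%E.
  apply: (Green_op_ge hgraph hconn hfin hT nd sg Lg c0 (w := fun n => projT1 (H n))).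
  - by move=> k; case: (projT2 (H k)).
  - by move=> k; case: (projT2 (H k)).
have <- : projT1 (H m) x = 1; last exact: ge.
case: (projT2 (H m)) => sw Lw; apply/eqP; rewrite -subr_eq0; apply/eqP.
have := maximum_principle0 hgraph hconn hfin (phi := fun x => projT1 (H m) x - 1) (nd m).
apply=> y yn; last by move: yn; rewrite ltnNge bounded.
by rewrite (LaplB hgraph hconn hfin) (Lapl_cst hgraph hconn hfin) Lw// mulr1 subrr.
Qed.

Lemma Green_op_finite_no_killing Tb x : is_heat_semigroup b (fun=> 0) o Tb ->
  Green_op Tb c x = +oo%E.
Proof.
move=> hT; apply/eqP; rewrite -leye_eq.
have G y : Green Tb x y = +oo%E.
  by apply: (Green_infinite hgraph0 hconn hfin hT x y (n := m)).
apply: esum_ge; exists [set z]; first by split; [exact: finite_set1|].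
by rewrite fsbig_set1 G gt0_mulye.
Qed.

End FiniteGraph.

(** * Killing with all spheres nonempty: each property amounts to divergence *)

Section InfiniteGraph.
Hypothesis infinite : forall r, exists x, gdist b x o = r.

Let flux_gt0 r : 0 < sphere_flux b o r.
Proof. by have [x xr] := infinite r.+1; exact: (sphere_flux_gt0 hgraph hconn hsym xr). Qed.

Let ratio := mass_flux_ratio b c o.
Let diverges := forall M, exists n, M < \sum_(r < n) ratio r.
Let sol := radial_sol b c o.

Let sol_gt0 r : 0 < sol r.
Proof. exact: lt_le_trans (radial_sol_ge1 o hgraph r). Qed.

Lemma series_infiniteP : series = +oo%E <-> diverges.
Proof.
rewrite seriesE; apply: iff_trans (nneseries_infiniteP (mass_flux_ratio_ge0 o hgraph)).
rewrite (_ : (\sum_(0 <= r <oo) (mass_flux_ratio b c o r)%:E)%E =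
  (\sum_(0 <= r <oo) ((ball_mass b c o r)%:E / (sphere_flux b o r)%:E))%E)//.
by apply: eq_eseriesr => r _; rewrite inver gt_eqF// -EFinM.
Qed.

Let converges_bound : ~ diverges -> exists M, forall n, \sum_(r < n) ratio r <= M.
Proof.
move=> /existsNP[M /forallNP nM]; exists M => n; rewrite leNgt; exact/negP/nM.
Qed.

Let sol_bound : ~ diverges -> exists2 B, 0 < B & forall n, sol n <= B.
Proof.
move=> /converges_bound[M bM]; exists (expR M); first exact: expR_gt0.
move=> n; apply: le_trans (radial_sol_upper o hgraph n) _.
by rewrite ler_expR.
Qed.

Let sol_unbounded : diverges -> forall M, exists n, M < sol n.+1.
Proof.
move=> div M; have [n Mn] := div M; exists n.
apply: lt_le_trans Mn _; apply: le_trans (radial_sol_le o hgraph (leqnSn n)).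
by apply: le_trans (radial_sol_lower o hgraph n); rewrite lerDr.
Qed.

Let profile n x := ball_profile b c o n (gdist b x o).

Let profile_supp n : supp_ball b o n (profile n).
Proof. by move=> x; exact: (ball_profile_supp hgraph). Qed.

Let Lapl_profile n x : (gdist b x o <= n)%N -> Lapl b c (profile n) x = c x.
Proof. exact: (Lapl_ball_profile hgraph hconn hsym infinite). Qed.

Let profile_close x (e : R) : diverges -> 0 < e -> exists n, 1 - e <= profile n x.
Proof.
move=> div e0; have [n nx] := sol_unbounded div (sol (gdist b x o) / e).
exists n; rewrite /profile /ball_profile le_max; apply/orP; right.
rewrite lerD2l lerN2 ler_pdivrMr ?sol_gt0//.
by move: nx; rewrite ltr_pdivrMr// mulrC => /ltW.
Qed.

Lemma Liouville_infiniteP : Liouville <-> diverges.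
Proof.
split=> [L|div u [M uM] [_ Lu] x].
  apply: contrapT => /sol_bound[B _ bB].
  have : sol (gdist b o o) = 0.
    apply: (L (fun x => sol (gdist b x o))).
      by exists B => x; rewrite ger0_norm// ltW.
    split; first exact: in_F_all hgraph hconn hfin _.
    exact: radial_sol_harmonic hgraph hconn hsym infinite.
  by move/eqP; rewrite gt_eqF.
have M0 : 0 <= M by apply: le_trans (uM o).
(* The barrier [M * (1 - profile n)] is harmonic on the ball and equals [M] outside it; it is used
   for [u] and for [- u]. *)
have key n (v : X -> R) : (forall y, Lapl b c v y = 0) -> (forall y, `|v y| <= M) ->
    0 <= M * (1 - profile n x) + v x.
  move=> Lv vM.
  have := maximum_principle hgraph hconn hfin
    (phi := fun y => M * (1 - profile n y) + v y) (nd n).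
  apply=> y yn.
    rewrite (LaplD hgraph hconn hfin) Lv addr0 (LaplB hgraph hconn hfin).
    by rewrite (Lapl_cst hgraph hconn hfin) Lapl_profile// mulr1 subrr mulr0.
  by rewrite profile_supp// subr0 mulr1; have := vM y; rewrite ler_norml => /andP[]; lra.
have Lnu y : Lapl b c (fun y => - u y) y = 0.
  rewrite (_ : (fun y => - u y) = (fun y => (fun=> 0) y - u y)); last first.
    by apply/funext => t; rewrite sub0r.
  by rewrite (LaplB hgraph hconn hfin) (Lapl_cst hgraph hconn hfin) Lu mulr0 subr0.
apply/eqP; rewrite -normr_le0; apply/ler_addgt0Pr => e e0; rewrite add0r.
have M1 : 0 < M + 1 by lra.
have [n pn] := profile_close x div (divr_gt0 e0 M1).
have k1 := key n u Lu uM.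
have k2 := key n (fun y => - u y) Lnu (fun y => etrans (congr1 (<=%R^~ M) (normrN _)) (uM y)).
have small : M * (1 - profile n x) <= e.
  apply: (@le_trans _ _ (M * (e / (M + 1)))); first by rewrite ler_wpM2l//; lra.
  by rewrite mulrA ler_pdivrMr// mulrC ler_wpM2l ?(ltW e0)// lerDl.
by rewrite ler_norml; move: k1 k2 small => /=; lra.
Qed.

Lemma Green_op_infiniteP T : is_heat_semigroup b c o T ->
  (forall x, Green_op T c x = 1%E) <-> diverges.
Proof.
move=> hT; have [g [sg Lg]] := dirichlet_green_family hgraph hconn hfin nd.
split=> [G1|div x].
  apply: contrapT => /sol_bound[B B0 bB].
  (* The profile at [o] is 1 - 1/f(n+1), because f(0) = 1, and f is bounded by [B]. *)
  have : (Green_op T c o <= (1 - B^-1)%:E)%E.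
    apply: (Green_op_le hgraph hconn hfin hT nd sg Lg c0 profile_supp Lapl_profile) => n.
    rewrite /profile (gdist_root o hconn) (ball_profileE o hgraph)// lerD2l lerN2 mul1r.
    by rewrite lef_pV2 ?posrE.
  by rewrite G1 lee_fin => h; have : 0 < B^-1; [rewrite invr_gt0|lra].
apply/eqP; rewrite eq_le Green_op_killing_le1//=.
have ge n : ((profile n x)%:E <= Green_op T c x)%E.
  exact: (Green_op_ge hgraph hconn hfin hT nd sg Lg c0 profile_supp Lapl_profile).
apply/lee_addgt0Pr => e e0; have [n pn] := profile_close x div e0.
apply: (@le_trans _ _ ((profile n x)%:E + e%:E)%E); last by rewrite leeD2r.
by rewrite -EFinD lee_fin; lra.
Qed.

Lemma Green_op_no_killing_infiniteP Tb : is_heat_semigroup b (fun=> 0) o Tb ->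
  (forall x, Green_op Tb c x = +oo%E) <-> diverges.
Proof.
move=> hT.
(* Without killing, solvability on balls comes from the vertices outside them. *)
have nd0 n : nondegenerate_ball b (fun=> 0) o n.
  by right; have [x xn] := infinite n.+1; exists x; rewrite xn.
have [g [sg Lg]] := dirichlet_green_family hgraph0 hconn hfin nd0.
pose v n x := ball_potential b c o n (gdist b x o).
have sv n : supp_ball b o n (v n) by move=> x; exact: (ball_potential_supp c).
have Lv n x : (gdist b x o <= n)%N -> Lapl b (fun=> 0) (v n) x = c x.
  exact: (Lapl_ball_potential hgraph hconn hsym infinite).
split=> [Gy|div x].
  apply: contrapT => /converges_bound[B bB].
  have : (Green_op Tb c o <= B%:E)%E.
    apply: (Green_op_le hgraph0 hconn hfin hT nd0 sg Lg c0 sv Lv) => n.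
    by rewrite /v (gdist_root o hconn) /ball_potential big_mkord.
  by rewrite Gy leye_eq.
apply/eqyP => M _; set r := gdist b x o.
(* The potential at [x] misses the first r terms of the series, so they are added to the target. The
   radius [maxn r n] keeps [x] in the ball and includes the terms below n. *)
have [n] := div (M + \sum_(k < r) ratio k) => Mn.
apply: (@le_trans _ _ (v (maxn r n) x)%:E); last first.
  exact: (Green_op_ge hgraph0 hconn hfin hT nd0 sg Lg c0 sv Lv).
have ratio0 k : 0 <= ratio k by exact: mass_flux_ratio_ge0.
have split_sum : \sum_(k < (maxn r n).+1) ratio k = \sum_(k < r) ratio k + v (maxn r n) x.
  rewrite -!(big_mkord xpredT ratio) /v /ball_potential -/r.
  by rewrite -big_cat_nat//= leqW// leq_maxl.
have mono : \sum_(k < n) ratio k <= \sum_(k < (maxn r n).+1) ratio k.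
  rewrite -!(big_mkord xpredT ratio) [leRHS](@big_cat_nat _ _ _ n)//=.
    by rewrite lerDl sumr_ge0.
  by rewrite leqW// leq_maxr.
by rewrite lee_fin; move: Mn mono split_sum; lra.
Qed.

End InfiniteGraph.

End Killing.

End Dichotomy.

(* In \bar R, a / 0 = +oo for a > 0 and 0 / 0 = 0. *)
Theorem theorem33 (R : realType) (X : countType)
    (b : X -> X -> R) (c : X -> R) (o : X)
    (hgraph : is_graph b c) (hconn : connected_graph b)
    (hsym : weakly_spherically_symmetric b c o) :
  ((forall u : X -> R, bounded_on_graph u -> graph_harmonic b c u -> forall x, u x = 0)
     <->
   (\sum_(0 <= r <oo) (c_set c (gball b o r) / bplus_set b o (gsphere b o r))
      = +oo)%E)
  /\
  (forall T Tb : R -> (X -> R) -> X -> R,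
     is_heat_semigroup b c o T ->
     is_heat_semigroup b (fun _ => 0) o Tb ->
     ((forall x, Green_op T c x = 1%E) <->
      (forall x, Green_op Tb c x = +oo%E))).
Proof.
have [[z cz]|/forallNP nokill] := pselect (exists z, 0 < c z); last first.
  have c_eq0 x : c x = 0.
    apply/eqP; rewrite eq_le; have [_ _ _ _ ->] := hgraph.
    by rewrite andbT leNgt; exact/negP/nokill.
  split.
    rewrite (series_no_killing hgraph hconn hsym c_eq0).
    by split=> [/(not_Liouville_no_killing hgraph hconn hsym c_eq0)|].
  move=> T Tb _ _; split=> /(_ o); rewrite Green_op_no_killing//.
    by move=> /eqP; rewrite eqe eq_sym oner_eq0.
have [infinite|/existsNP[m empty]] := pselect (forall r, exists x, gdist b x o = r).
  split.
    by rewrite (series_infiniteP hgraph)// (Liouville_infiniteP hgraph hconn hsym cz).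
  move=> T Tb hT hTb.
  rewrite (Green_op_infiniteP hgraph hconn hsym cz infinite hT).
  by rewrite (Green_op_no_killing_infiniteP hgraph hconn hsym infinite hTb).
(* Predecessors lower the distance by exactly one, so a vertex beyond distance m would lead down to
   one in the empty sphere. *)
have bounded x : (gdist b x o <= m)%N.
  rewrite leqNgt; apply/negP => /ltnW mx; apply: empty.
  have [k] := ubnP (gdist b x o); elim: k x mx => // k IH x mx xk.
  have [xm|xm] := eqVneq (gdist b x o) m; first by exists x.
  case xr: (gdist b x o) => [|r]; first by move: mx xm; rewrite xr leqn0 eq_sym => ->.
  have [y _ yr] := gdist_pred hgraph hconn xr.
  by apply: (IH y); rewrite yr; move: mx xm xk; rewrite xr; lia.
split.
  split=> _; first exact: (series_finite hgraph hconn hsym cz bounded).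
  exact: (Liouville_finite hgraph hconn hsym cz bounded).
move=> T Tb hT hTb; split=> _ x.
  exact: (Green_op_finite_no_killing hgraph hconn hsym cz bounded).
exact: (Green_op_finite hgraph hconn hsym cz bounded).
Qed.
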